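(* There exist two positive constants $\Theta$ and $C$, depending only on $n$, $s$, and $g$, such that the following holds true. If $\Omega\subseteq\mathbb{R}^n$ is a bounded open set with Lipschitz boundary, $\varphi:\mathbb{R}^n\setminus\Omega\to\mathbb{R}$ is a measurable function such that $\mathrm{Tail}_s(\varphi,\Omega_{\Theta\,\mathrm{diam}(\Omega)}\setminus\Omega;\,\cdot\,)\in L^1(\Omega)$, and $u\in\mathcal{W}^s_\varphi(\Omega)$ is such that $$\mathcal{F}^M(u,\Omega)\le\mathcal{F}^M(v,\Omega)\quad\text{for every } v\in\mathcal{W}^s_\varphi(\Omega)\text{ such that }|v|\le M\text{ a.e. in }\Omega,$$ for some $M\ge0$, then $$\mathrm{diam}(\Omega)^{-s}\|u\|_{L^1(\Omega)}+[u]_{W^{s,1}(\Omega)}\le C\left(\left\|\mathrm{Tail}_s(\varphi,\Omega_{\Theta\,\mathrm{diam}(\Omega)}\setminus\Omega;\,\cdot\,)\right\|_{L^1(\Omega)}+\mathrm{diam}(\Omega)^{1-s}|\Omega|\right).$$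
   Context: $n\ge1$ is an integer, $s\in(0,1)$, and $g:\mathbb{R}\to(0,1]$ is an even continuous function with $\int_{\mathbb{R}}g(t)|t|\,dt<\infty$. Set $G(t):=\int_0^t g(\tau)\,d\tau$, $\mathcal{G}(t):=\int_0^t G(\tau)\,d\tau$, $\overline{G}(t):=\int_{-\infty}^tg(\tau)\,d\tau$. $[u]_{W^{s,1}(\Omega)}:=\int_\Omega\int_\Omega\frac{|u(x)-u(y)|}{|x-y|^{n+s}}\,dx\,dy$; $\mathcal{W}^s(\Omega)$ is the set of measurable $u:\mathbb{R}^n\to\mathbb{R}$ with $u|_\Omega\in W^{s,1}(\Omega)$ (i.e. $u|_\Omega\in L^1(\Omega)$ and $[u]_{W^{s,1}(\Omega)}<\infty$), and $\mathcal{W}^s_\varphi(\Omega):=\{v\in\mathcal{W}^s(\Omega): v=\varphi\text{ a.e. in }\mathbb{R}^n\setminus\Omega\}$. For $M\ge0$, $\mathcal{F}^M(u,\Omega):=\mathcal{A}(u,\Omega)+\mathcal{N}^M(u,\Omega)$, where $$\mathcal{A}(u,\Omega):=\int_\Omega\int_\Omega\mathcal{G}\left(\frac{u(x)-u(y)}{|x-y|}\right)\frac{dx\,dy}{|x-y|^{n-1+s}},$$ $$\mathcal{N}^M(u,\Omega):=\int_\Omega\left\{\int_{\mathbb{R}^n\setminus\Omega}\left(\int_{\frac{-M-u(y)}{|x-y|}}^{\frac{u(x)-u(y)}{|x-y|}}\overline{G}(t)\,dt+\int_{\frac{u(x)-u(y)}{|x-y|}}^{\frac{M-u(y)}{|x-y|}}\overline{G}(-t)\,dt\right)\frac{dy}{|x-y|^{n-1+s}}\right\}dx.$$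 For bounded Lipschitz $\Omega$, $\mathcal{F}^M(u,\Omega)$ is finite for every $u\in\mathcal{W}^s(\Omega)$. $\Omega_\varrho:=\{x\in\mathbb{R}^n:\mathrm{dist}(x,\Omega)<\varrho\}$ for $\varrho>0$. For measurable $O\subseteq\mathbb{R}^n\setminus\Omega$ and $x\in\Omega$, $\mathrm{Tail}_s(\varphi,O;x):=\int_O\frac{|\varphi(y)|}{|x-y|^{n+s}}\,dy$. *)

(* Defs.v *)
From HB Require Import structures.
From mathcomp Require Import all_boot all_order all_algebra.
From mathcomp Require Import all_classical all_reals all_analysis.

Set Implicit Arguments.
Unset Strict Implicit.
Unset Printing Implicit Defensive.
Import Order.TTheory GRing.Theory Num.Theory.
Import numFieldNormedType.Exports.

Local Open Scope classical_set_scope.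
Local Open Scope ring_scope.

(* R^n is 'rV[R]_n, with its library topology.  It is given the sigma-algebra
   generated by the coordinates (the Borel sets) and n-dimensional Lebesgue
   measure, built by iterating the product with the Lebesgue measure of R. *)

Definition rV_display : measure_display.
Proof. exact: default_measure_display. Qed.

Section rV_measurable.
Context {R : realType} {n : nat}.

Let coord (i : 'I_n) (x : 'rV[R]_n) : measurableTypeR R := x ord0 i.

Let rV_set0 : g_sigma_preimage coord set0.
Proof. exact: sigma_algebra0. Qed.

Let rV_setC A : g_sigma_preimage coord A -> g_sigma_preimage coord (~` A).
Proof. exact: sigma_algebraC. Qed.

Let rV_bigcup (F : (set _)^nat) : (forall i, g_sigma_preimage coord (F i)) ->
  g_sigma_preimage coord (\bigcup_i (F i)).
Proof. exact: sigma_algebra_bigcup. Qed.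

HB.instance Definition _ := @isMeasurable.Build rV_display
  'rV[R]_n (g_sigma_preimage coord) rV_set0 rV_setC rV_bigcup.

End rV_measurable.

Section rV_measurable_theory.
Context {R : realType}.

Lemma measurable_coord n (i : 'I_n) :
  measurable_fun [set: 'rV[R]_n] (fun x => x ord0 i : measurableTypeR R).
Proof.
move=> _ Y mY; rewrite setTI; apply: sub_sigma_algebra => /=.
rewrite -bigcup_seq/=; exists i => /=; first by rewrite mem_index_enum.
by exists Y => //; rewrite setTI.
Qed.

Lemma measurable_fun_coordP d (T : measurableType d) n (f : T -> 'rV[R]_n) :
  measurable_fun [set: T] f <->
  forall i, measurable_fun [set: T] (fun t => f t ord0 i : measurableTypeR R).
Proof.
split=> [mf i|mf]; first exact: measurableT_comp (measurable_coord i) mf.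
move=> _ Y mY; rewrite setTI.
suff : measurable `<=` [set A : set 'rV[R]_n | measurable (f @^-1` A)] by apply.
apply: smallest_sub.
  split => /=; first by rewrite preimage_set0.
    by move=> A mA; rewrite setTD preimage_setC; exact: measurableC.
  by move=> F mF; rewrite preimage_bigcup; exact: bigcup_measurable.
rewrite -bigcup_seq/= => A [i _ [B mB <-]] /=.
by have := mf i measurableT _ mB; rewrite !setTI.
Qed.

Definition row_cons n (p : measurableTypeR R * 'rV[R]_n) : 'rV[R]_n.+1 :=
  \row_i if unlift ord0 i is Some j then p.2 ord0 j else p.1.

Lemma row_cons0 n (p : measurableTypeR R * 'rV[R]_n) :
  row_cons p ord0 ord0 = p.1.
Proof. by rewrite mxE unlift_none. Qed.

Lemma row_consS n (p : measurableTypeR R * 'rV[R]_n) (i : 'I_n) :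
  row_cons p ord0 (lift ord0 i) = p.2 ord0 i.
Proof. by rewrite mxE liftK. Qed.

Lemma measurable_row_cons n : measurable_fun setT (@row_cons n).
Proof.
apply/measurable_fun_coordP => i; case: (unliftP ord0 i) => [j|] ->.
- under eq_fun do rewrite row_consS.
  exact: measurableT_comp (measurable_coord j) measurable_snd.
- under eq_fun do rewrite row_cons0.
  exact: measurable_fst.
Qed.

End rV_measurable_theory.

Section lebesgue_step.
Local Open Scope ereal_scope.
Context {R : realType} {n : nat}.
Variable mu : {sigma_finite_measure set 'rV[R]_n -> \bar R}.

Definition lebesgue_step : set 'rV[R]_n.+1 -> \bar R :=
  pushforward (lebesgue_measure \x mu) (@row_cons R n).

Let mpre (A : set 'rV[R]_n.+1) :
  measurable A -> measurable (@row_cons R n @^-1` A).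
Proof.
by move=> mA; rewrite -[X in measurable X]setTI; exact: measurable_row_cons.
Qed.

Let step0 : lebesgue_step set0 = 0.
Proof. by rewrite /lebesgue_step /pushforward preimage_set0 measure0. Qed.

Let step_ge0 A : 0 <= lebesgue_step A.
Proof. by rewrite /lebesgue_step /pushforward measure_ge0. Qed.

Let step_sigma_additive : semi_sigma_additive lebesgue_step.
Proof.
move=> F mF tF mUF; rewrite /lebesgue_step /pushforward preimage_bigcup.
apply: measure_semi_sigma_additive => [k||]; first exact: mpre.
- apply/trivIsetP => /= i j _ _ ij; rewrite -preimage_setI.
  by move/trivIsetP : tF => /(_ _ _ _ _ ij) ->//; rewrite preimage_set0.
- by rewrite -preimage_bigcup; exact: mpre.
Qed.

HB.instance Definition _ := isMeasure.Build _ _ _ lebesgue_step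
  step0 step_ge0 step_sigma_additive.

Lemma lebesgue_stepX (A : set (measurableTypeR R))
    (B : 'I_n -> set (measurableTypeR R)) :
    measurable A -> (forall i, measurable (B i)) ->
  lebesgue_step [set x | A (x ord0 ord0) /\
    forall i, B i (x ord0 (lift ord0 i))] =
  lebesgue_measure A * mu [set y | forall i, B i (y ord0 i)].
Proof.
move=> mA mB.
have mBn : measurable [set y : 'rV[R]_n | forall i, B i (y ord0 i)].
  rewrite [X in measurable X](_ : _ = \big[setI/setT]_(i < n)
      ((fun y : 'rV[R]_n => y ord0 i) @^-1` B i)).
    apply: bigsetI_measurable => i _; rewrite -[X in measurable X]setTI.
    exact: (measurable_coord i measurableT (mB i)).
  rewrite -bigcap_seq; apply/seteqP.
  split=> y /= By i => [_|]; first exact: By.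
  by apply: By => /=; rewrite mem_index_enum.
rewrite /lebesgue_step /pushforward -product_measure1E//.
congr (_ _); apply/seteqP; split=> p /=; rewrite row_cons0 => -[Ap Bp].
  by split=> // i; rewrite -row_consS.
by split=> // i; rewrite row_consS.
Qed.

Let uncons (x : 'rV[R]_n.+1) : 'rV[R]_n := \row_i x ord0 (lift ord0 i).

Let measurable_uncons : measurable_fun setT uncons.
Proof.
apply/measurable_fun_coordP => i; under eq_fun do rewrite mxE.
exact: measurable_coord.
Qed.

Let row_consK p : uncons (@row_cons R n p) = p.2.
Proof. by apply/rowP => i; rewrite mxE row_consS. Qed.

Let step_sigma_finite : sigma_finite setT lebesgue_step.
Proof.
have /sigma_finiteP[F [TF ndF Foo]] :=
  sigma_finiteT (@lebesgue_measure R : {sigma_finite_measure set _ -> \bar R}).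
have /sigma_finiteP[G [TG ndG Goo]] := sigma_finiteT mu.
exists (fun k => ((fun x : 'rV[R]_n.+1 => x ord0 ord0) @^-1` F k) `&`
                 (uncons @^-1` G k)).
  apply/seteqP; split=> // x _.
  have : [set: R] (x ord0 ord0) by [].
  have : [set: 'rV[R]_n] (uncons x) by [].
  rewrite TG TF => -[j _ Gj] [k _ Fk]; exists (maxn j k) => //; split.
    by apply: (subsetPset _ _ (ndF _ _ (leq_maxr j k))).
  by apply: (subsetPset _ _ (ndG _ _ (leq_maxl j k))).
move=> k; have [mF Fk] := Foo k; have [mG Gk] := Goo k; split.
  apply: measurableI; rewrite -[X in measurable X]setTI.
    exact: (measurable_coord ord0 measurableT mF).
  exact: measurable_uncons.
rewrite /lebesgue_step /pushforward (_ : @row_cons R n @^-1` _ = F k `*` G k).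
  by rewrite product_measure1E// lte_mul_pinfty// ge0_fin_numE.
by apply/seteqP; split=> p /=; rewrite row_cons0 row_consK.
Qed.

HB.instance Definition _ := Measure_isSigmaFinite.Build _ _ _ lebesgue_step
  step_sigma_finite.

End lebesgue_step.

Fixpoint lebesgue_rV (R : realType) (n : nat) :
    {sigma_finite_measure set 'rV[R]_n -> \bar R} :=
  match n with
  | 0 => [the {sigma_finite_measure set 'rV[R]_0 -> \bar R} of \d_(0 : 'rV_0)]
  | m.+1 => [the {sigma_finite_measure set 'rV[R]_m.+1 -> \bar R} of
              lebesgue_step (lebesgue_rV R m)]
  end.

Lemma lebesgue_rV_box (R : realType) (n : nat) (A : 'I_n -> set (measurableTypeR R)) :
    (forall i, measurable (A i)) ->
  (lebesgue_rV R n [set x | forall i, A i (x ord0 i)] =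
  \prod_(i < n) lebesgue_measure (A i))%E.
Proof.
elim: n A => [|n IHn] A mA.
  rewrite big_ord0 /= /dirac indicE mem_set//=.
  by case.
rewrite big_ord_recl -(IHn (fun i => A (lift ord0 i)))//.
rewrite -(lebesgue_stepX _ (mA ord0) (fun i => mA (lift ord0 i))) /=.
congr (lebesgue_step _ _).
apply/seteqP; split=> x /= => [Ax|[A0 Ax] i]; first by split.
by case: (unliftP ord0 i) => [j|] ->.
Qed.

Section euclidean.
Context {R : realType} {n : nat}.
Implicit Types (x y : 'rV[R]_n) (Omega : set 'rV[R]_n).

(* The library norm of 'rV[R]_n is the sup norm. *)
Definition enorm x : R := Num.sqrt (\sum_(i < n) x ord0 i ^+ 2).

Definition diam Omega : R := sup [set enorm (x - y) | x in Omega & y in Omega].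

Definition dist x Omega : \bar R :=
  ereal_inf [set (enorm (x - y))%:E | y in Omega].

Definition enlarge Omega (rho : R) : set 'rV[R]_n :=
  [set x | (dist x Omega < rho%:E)%E].

(* Near each boundary point, and in suitable orthonormal coordinates x *m Q,
   Omega is the strict epigraph in the direction of the i-th coordinate of a
   Lipschitz function of the n - 1 remaining ones. *)
Definition lipschitz_boundary Omega : Prop :=
  forall x0, (closure Omega `\` interior Omega) x0 ->
  exists (Q : 'M[R]_n) (i : 'I_n) (psi : 'rV[R]_n.-1 -> R) (r : R),
    [/\ Q *m Q^T = 1%:M, lipschitz psi, 0 < r &
      forall x, enorm (x - x0) < r ->
        Omega x <-> psi (col' i (x *m Q)) < (x *m Q) ord0 i].

(* Lebesgue measurability: f agrees a.e. with a Borel function (D is always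
   Borel here).  The library integral of a function that agrees a.e. with a
   Borel one has the expected value, as nonnegative functions are integrated
   by a supremum over the simple functions below them. *)
Definition lebesgue_measurable_fun (D : set 'rV[R]_n) (f : 'rV[R]_n -> R) :=
  exists2 h : 'rV[R]_n -> R, measurable_fun D h &
    {ae lebesgue_rV R n, forall x, D x -> f x = h x}.

Definition normL1 Omega (f : 'rV[R]_n -> \bar R) : \bar R :=
  (\int[lebesgue_rV R n]_(x in Omega) `|f x|)%E.

Definition seminormWs1 (s : R) Omega (u : 'rV[R]_n -> R) : \bar R :=
  (\int[lebesgue_rV R n]_(x in Omega) \int[lebesgue_rV R n]_(y in Omega)
     (`|u x - u y| / enorm (x - y) `^ (n%:R + s))%:E)%E.

Definition Ws (s : R) Omega : set ('rV[R]_n -> R) :=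
  [set u | [/\ lebesgue_measurable_fun setT u,
               (normL1 Omega (EFin \o u) < +oo)%E &
               (seminormWs1 s Omega u < +oo)%E]].

Definition Ws_datum (s : R) Omega (phi : 'rV[R]_n -> R) : set ('rV[R]_n -> R) :=
  [set v | Ws s Omega v /\
    {ae lebesgue_rV R n, forall x, (~` Omega) x -> v x = phi x}].

Definition Tail (s : R) (phi : 'rV[R]_n -> R) (O : set 'rV[R]_n) x : \bar R :=
  (\int[lebesgue_rV R n]_(y in O)
     (`|phi y| / enorm (x - y) `^ (n%:R + s))%:E)%E.

End euclidean.

Section functional.
Context {R : realType}.

Definition oriented_int (f : R -> R) (a b : R) : R :=
  if a <= b then \int[lebesgue_measure]_(t in `[a, b]) f t
  else - \int[lebesgue_measure]_(t in `[b, a]) f t.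

Definition primG (g : R -> R) (t : R) : R := oriented_int g 0 t.

Definition primG2 (g : R -> R) (t : R) : R := oriented_int (primG g) 0 t.

Definition barG (g : R -> R) (t : R) : R :=
  \int[lebesgue_measure]_(tau in `]-oo, t]) g tau.

Context {n : nat}.
Implicit Types (Omega : set 'rV[R]_n) (u : 'rV[R]_n -> R).

Definition funcA (s : R) (g : R -> R) u Omega : \bar R :=
  (\int[lebesgue_rV R n]_(x in Omega) \int[lebesgue_rV R n]_(y in Omega)
     (primG2 g ((u x - u y) / enorm (x - y))
       / enorm (x - y) `^ (n%:R - 1 + s))%:E)%E.

Definition funcN (s : R) (g : R -> R) (M : R) u Omega : \bar R :=
  (\int[lebesgue_rV R n]_(x in Omega) \int[lebesgue_rV R n]_(y in ~` Omega)
     ((oriented_int (barG g)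
         ((- M - u y) / enorm (x - y)) ((u x - u y) / enorm (x - y))
       + oriented_int (fun t => barG g (- t))
         ((u x - u y) / enorm (x - y)) ((M - u y) / enorm (x - y)))
       / enorm (x - y) `^ (n%:R - 1 + s))%:E)%E.

Definition funcF (s : R) (g : R -> R) (M : R) u Omega : \bar R :=
  (funcA s g u Omega + funcN s g M u Omega)%E.

End functional.

(* Main.v *)
(** Test the minimality of u against the function v that vanishes in Omega and
    equals u outside. Then A(v) = 0, and if H(t) = barG(t) - barG(-t) = 2 G(t)
    and K is the primitive of H vanishing at 0, the integrands of N(u) and N(v)
    differ by (K((u(x) - u(y))/r) - K(-u(y)/r)) / r^(n-1+s), r = |x - y|.
    For y within distance Theta diam(Omega) of Omega the linear growth of K
    gives a gain c |u(x)| / r^(n+s), up to the tail of u and an integrable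
    kernel; for y further away the Lipschitz bound on K gives a loss of
    C |u(x)| / r^(n+s), whose integral in y is absorbed by the gain once Theta
    is large. N(v) is at most a multiple of the fractional perimeter of Omega,
    which is finite because Omega is Lipschitz, so that it can be cancelled.
    The linear growth of the density of A controls the seminorm of u. *)

Require Import Defs.
From mathcomp Require Import all_boot all_order all_algebra.
From mathcomp Require Import all_classical all_reals all_analysis.
From mathcomp Require Import measurable_realfun ring lra.
Set Implicit Arguments.
Unset Strict Implicit.
Unset Printing Implicit Defensive.
Import Order.TTheory GRing.Theory Num.Theory.
Import numFieldNormedType.Exports.

Local Open Scope classical_set_scope.
Local Open Scope ring_scope.

(** The minimizer is not assumed to be bounded by M, so the density of N(u) may change sign and its
    integrals are a priori infinite or a difference of infinities. Each comparison is therefore put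
    in the form k <= f + h with k and h nonnegative, f the signed quantity attached to u and h of
    finite integral. This bounds the negative part of f by h and makes integration legitimate, in y
    and then in x. The constants do not see M: the primitive K does not depend on it, and the bound
    of N(v), which does, serves only to know that N(v) is finite. Kernels are integrated over dyadic
    cubical shells and the perimeter over dyadic strips along the boundary; both become geometric
    series, convergent at the diagonal because n - 1 + s < n, at infinity because s > 0, and at the
    boundary because s < 1. Since u is measurable only up to a null set, the whole argument is run
    on a Borel representative of it. *)

(** Adding the negative part of f to both sides turns a signed inequality into one between
    nonnegative quantities, which can be integrated. Where h is infinite both conclusions hold
    trivially, hence the guard. *)
Lemma ereal_posneg_le (R : realType) (k f h : \bar R) :
    (0 <= k -> 0 <= h -> (h < +oo -> k <= f + h) ->
  maxe (- f) 0 <= h /\ k + maxe (- f) 0 <= maxe f 0 + h)%E.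
Proof.
case: h => [h| |] //; last first.
  move=> _ _ _; have p0 : (0 <= maxe f 0)%E by rewrite le_max lexx orbT.
  by rewrite addey ?leey//; case: (maxe f 0)%E p0.
case: k => [k| |] //.
  move=> k0 h0 /(_ (ltry _)); case: f => [f| |] // H; last first.
  by rewrite [(- +oo)%E]/= maxye maxNye lee_fin addye// leey.
  move: H k0 h0; rewrite !maxEle -!EFinN -?EFinD !lee_fin => H k0 h0.
  by case: ifP => H1; case: ifP => H2; rewrite -?EFinD !lee_fin; lra.
move=> _ h0 /(_ (ltry _)); case: f => [f| |] // _.
by rewrite [(- +oo)%E]/= maxye maxNye lee_fin addye// leey.
Qed.

(** * Comparison of integrals: almost everywhere, signed, and by geometric series *)

Section integral_comparison.
Local Open Scope ereal_scope.
Context d {T : measurableType d} {R : realType}.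
Variable mu : {measure set T -> \bar R}.

Import HBNNSimple.

(* No measurability of f and g: the integral of a nonnegative function is
   defined as a supremum over all simple functions below it. *)
Lemma ge0_le_integral_ae (D : set T) (f g : T -> \bar R) :
    (forall x, D x -> 0 <= f x) -> (forall x, D x -> 0 <= g x) ->
    {ae mu, forall x, D x -> f x <= g x} ->
  \int[mu]_(x in D) f x <= \int[mu]_(x in D) g x.
Proof.
move=> f0 g0 fg; rewrite integral_mkcond [leRHS]integral_mkcond.
have p0 h : (forall x, D x -> 0 <= h x) -> forall x, 0 <= (h \_ D) x.
  by move=> h0 x; rewrite patchE; case: ifPn => // /set_mem /h0.
rewrite !ge0_integralTE; [|exact: p0..].
case: fg => N [mN muN fgN].
apply: ub_ereal_sup => _ [/= h hf <-].
have mNC : measurable (~` N) by exact: measurableC.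
(* Setting the simple function h to 0 on the exceptional null set keeps its integral and puts it
   below g everywhere. *)
have -> : sintegral mu h = sintegral mu (proj_nnsfun h mNC).
  rewrite -!integralT_nnsfun; apply: ge0_ae_eq_integral => //.
  - exact/measurable_EFinP.
  - exact/measurable_EFinP.
  - by move=> x _; rewrite lee_fin.
  - by move=> x _; rewrite lee_fin.
  exists N; split=> // x /= /not_implyP [_ hx]; apply: contrapT => Nx.
  by apply: hx; rewrite mindicE mem_set// mulr1.
apply: ereal_sup_ubound; exists (proj_nnsfun h mNC) => //= x.
rewrite mindicE; have [/set_mem /= Nx|_] := boolP (x \in ~` N); last first.
  by rewrite mulr0; exact: p0.
rewrite mulr1; apply: le_trans (hf x) _.
rewrite !patchE; case: ifPn => // /set_mem Dx.
by apply: contrapT => nfg; apply/Nx/fgN => /= /(_ Dx).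
Qed.

(** Positive and negative parts are compared in both directions by [ge0_le_integral_ae]. This is
    what allows the passage to a Borel representative of u inside every integral. *)
Lemma integral_ae_eq (D : set T) (f g : T -> \bar R) :
    {ae mu, forall x, D x -> f x = g x} ->
  \int[mu]_(x in D) f x = \int[mu]_(x in D) g x.
Proof.
move=> fg; rewrite integralE [RHS]integralE.
have sym (h k : T -> \bar R) : (forall x, 0 <= h x) -> (forall x, 0 <= k x) ->
    {ae mu, forall x, D x -> h x = k x} ->
    \int[mu]_(x in D) h x = \int[mu]_(x in D) k x.
  move=> h0 k0 hk; apply/eqP; rewrite eq_le !ge0_le_integral_ae//.
    by apply: filterS hk => x /[apply] ->.
  by apply: filterS hk => x /[apply] ->.
congr (_ - _); apply: sym => //; apply: filterS fg => x /[apply] fgx.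
  by rewrite !funeposE fgx.
by rewrite !funenegE fgx.
Qed.

(* Where h is infinite the sum f + h may be the junk value -oo + oo. *)
Lemma integral_le_signedD (D : set T) (k f h : T -> \bar R) :
    measurable D -> measurable_fun D k -> measurable_fun D f ->
    measurable_fun D h ->
    (forall x, D x -> 0 <= k x) -> (forall x, D x -> 0 <= h x) ->
    (forall x, D x -> h x < +oo -> k x <= f x + h x) ->
    \int[mu]_(x in D) h x < +oo ->
  \int[mu]_(x in D) k x <= \int[mu]_(x in D) f x + \int[mu]_(x in D) h x /\
  \int[mu]_(x in D) f x != -oo.
Proof.
move=> mD mk mf mh k0 h0 kfh hoo.
have mp := measurable_funepos mf.
have mn := measurable_funeneg mf.
have negh x : D x -> f^\- x <= h x.
  by move=> Dx; rewrite funenegE; have [] := ereal_posneg_le (k0 _ Dx) (h0 _ Dx) (kfh _ Dx).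
have sumh x : D x -> k x + f^\- x <= f^\+ x + h x.
  move=> Dx; rewrite funenegE funeposE.
  by have [] := ereal_posneg_le (k0 _ Dx) (h0 _ Dx) (kfh _ Dx).
have noo : \int[mu]_(x in D) f^\- x < +oo.
  by apply: le_lt_trans hoo; apply: ge0_le_integral.
have : \int[mu]_(x in D) (k x + f^\- x) <= \int[mu]_(x in D) (f^\+ x + h x).
  apply: ge0_le_integral => //.
  - by move=> x Dx; rewrite adde_ge0// k0.
  - exact: emeasurable_funD.
  - exact: emeasurable_funD.
rewrite !ge0_integralD// !(integralE mu D f).
have n0 : 0 <= \int[mu]_(x in D) f^\- x by exact: integral_ge0.
have p0 : 0 <= \int[mu]_(x in D) f^\+ x by exact: integral_ge0.
have h0' : 0 <= \int[mu]_(x in D) h x by exact: integral_ge0.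
have k0' : 0 <= \int[mu]_(x in D) k x by exact: integral_ge0.
move: noo n0 p0 h0' k0' hoo.
case: (\int[mu]_(x in D) f^\- x) => [a||]//.
case: (\int[mu]_(x in D) f^\+ x) => [b||]//;
case: (\int[mu]_(x in D) h x) => [c||]//;
case: (\int[mu]_(x in D) k x) => [e||]// _ _ _ _ _ _;
rewrite -?EFinD ?lee_fin ?leey //=.
move=> H; split=> //.
all: rewrite -?EFinN -?EFinD ?lee_fin ?addye ?leey //.
by lra.
Qed.

(** The series of the functions [a k] times the indicator of [E k] dominates f, since a single term
    suffices at each point where f is positive, and its integral is at most a geometric sum. The
    sets will be shells around a point, then strips along the boundary. *)
Lemma integral_geometric_cover (D : set T) (E : (set T)^nat) (a : R ^nat)
    (A z : R) (f : T -> \bar R) :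
    (forall k, measurable (E k)) -> measurable D ->
    (forall x, D x -> 0 < f x -> exists k, E k x) ->
    (forall x, D x -> 0 <= f x) -> (forall k, 0 <= a k)%R ->
    (forall k x, D x -> E k x -> f x <= (a k)%:E) ->
    (0 <= A)%R -> (0 < z < 1)%R ->
    (forall k, (a k)%:E * mu (E k) <= (A * z ^+ k)%:E) ->
  \int[mu]_(x in D) f x <= (A / (1 - z))%:E.
Proof.
move=> mE mD DE f0 a0 fa A0 /andP[z0 z1] aE.
have s0 k x : 0 <= (a k * \1_(E k) x)%:E by rewrite lee_fin mulr_ge0.
have mi k : measurable_fun setT (fun x => (a k * \1_(E k) x)%:E).
  by apply/measurable_EFinP; apply: measurable_funM => //; exact: measurable_indic.
apply: (@le_trans _ _ (\int[mu]_(x in D) \sum_(k <oo) (a k * \1_(E k) x)%:E)).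
  apply: ge0_le_integral_ae => //.
    by move=> x Dx; apply: nneseries_ge0 => k _ _; exact: s0.
  apply: aeW => x Dx.
  have /predU1P[<-|fx0] : (0 == f x) || (0 < f x) by rewrite -le_eqVlt f0.
    by apply: nneseries_ge0 => k _ _; exact: s0.
  have [k Ek] := DE _ Dx fx0.
  apply: (le_trans (fa _ _ Dx Ek)).
  apply: (@le_trans _ _ (\sum_(0 <= i < k.+1) (a i * \1_(E i) x)%:E)).
    rewrite big_nat_recr//= indicE mem_set// mulr1 leeDr//.
    by apply: sume_ge0 => i _; exact: s0.
  by apply: nneseries_lim_ge => i _ _; exact: s0.
rewrite integral_nneseries//; last by move=> k; exact: measurable_funS (mi k).
apply: lime_le.
  apply: is_cvg_ereal_nneg_natsum => k _; apply: integral_ge0 => x _; exact: s0.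
apply: nearW => m.
apply: (@le_trans _ _ (\sum_(0 <= i < m) (A * z ^+ i)%:E)).
  apply: lee_sum => k _; apply: le_trans (aE k).
  under eq_integral do rewrite EFinM.
  rewrite ge0_integralZl_EFin//; last first.
    by apply/measurable_EFinP; exact: measurable_indic.
  rewrite integral_indic// lee_wpmul2l ?lee_fin//.
  by apply: le_measure; rewrite ?inE//; exact: measurableI.
rewrite sumEFin lee_fin.
by have := @geometric_le_lim R m A z A0 z0; rewrite gtr0_norm// => /(_ z1).
Qed.

End integral_comparison.

Lemma lipschitz_continuous (R : realType) (V : normedModType R) (f : V -> R) (L : R) :
  (forall x y, `|f x - f y| <= L * `|x - y|) -> continuous f.
Proof.
move=> fL x; apply/cvgrPdist_lt => e e0.
have L0 : 0 < `|L| + 1 by rewrite ltr_pwDr.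
near=> y.
apply: le_lt_trans (fL _ _) _.
apply: (@le_lt_trans _ _ ((`|L| + 1) * `|x - y|)).
  by rewrite ler_wpM2r// (le_trans (ler_norm L))// lerDl.
rewrite mulrC -ltr_pdivlMr//.
near: y; apply: (@cvgr_dist_lt _ _ _ _ _ id x); last by rewrite divr_gt0.
exact: cvg_id.
Unshelve. all: by end_near. Qed.

(** * Oriented integrals on the line *)

Section oriented_integral.
Context {R : realType}.
Implicit Types (f g : R -> R) (a b c : R).
Local Notation mu := (@lebesgue_measure R).

Lemma continuous_integrable_itv f a b :
  continuous f -> mu.-integrable `[a, b] (EFin \o f).
Proof.
move=> cf; apply: continuous_compact_integrable; first exact: segment_compact.
exact: continuous_subspaceT.
Qed.

Lemma Rintegral_itv_add f a b c : continuous f -> a <= b -> b <= c ->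
  \int[mu]_(t in `[a, b]) f t + \int[mu]_(t in `[b, c]) f t =
  \int[mu]_(t in `[a, c]) f t.
Proof.
move=> cf ab bc.
have := @Rintegral_itvB R f (BLeft a) (BRight c) b
  (continuous_integrable_itv a c cf).
rewrite !bnd_simp => /(_ ab bc) H.
rewrite -(@Rintegral_itv_obnd_cbnd _ b) -?H; first by rewrite addrC subrK.
apply: integrableS (continuous_integrable_itv b c cf) => //.
by apply: subset_itvr; rewrite bnd_simp.
Qed.

Lemma Rintegral_itv1 f a : \int[mu]_(t in `[a, a]) f t = 0.
Proof. by rewrite set_itv1 Rintegral_set1. Qed.

Lemma oriented_int_le f a b : a <= b ->
  oriented_int f a b = \int[mu]_(t in `[a, b]) f t.
Proof. by move=> ab; rewrite /oriented_int ab. Qed.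

Lemma oriented_intC f a b : oriented_int f a b = - oriented_int f b a.
Proof.
rewrite /oriented_int; case: (ltgtP a b) => [|_|->]; rewrite ?opprK//.
by rewrite Rintegral_itv1 oppr0.
Qed.

Lemma oriented_int_chasles f a b c : continuous f ->
  oriented_int f a b + oriented_int f b c = oriented_int f a c.
Proof.
move=> cf.
have H x y z : x <= y -> y <= z ->
    oriented_int f x y + oriented_int f y z = oriented_int f x z.
  move=> xy yz; rewrite !oriented_int_le//; last exact: le_trans yz.
  exact: Rintegral_itv_add.
have C := oriented_intC f.
case: (leP a b) => [ab|/ltW ba]; case: (leP b c) => [bc|/ltW cb].
- exact: H.
- case: (leP a c) => [ac|/ltW ca].
    by have := H _ _ _ ac cb; rewrite (C b c); lra.
  by have := H _ _ _ ca ab; rewrite (C b c) (C a c); lra.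
- case: (leP a c) => [ac|/ltW ca].
    by have := H _ _ _ ba ac; rewrite (C a b); lra.
  by have := H _ _ _ bc ca; rewrite (C a b) (C a c); lra.
- by have := H _ _ _ cb ba; rewrite (C a b) (C b c) (C a c); lra.
Qed.

Lemma oriented_intB f g a b : continuous f -> continuous g ->
  oriented_int (fun t => f t - g t) a b =
  oriented_int f a b - oriented_int g a b.
Proof.
move=> cf cg; rewrite /oriented_int; case: ifP => _.
  by rewrite RintegralB//; exact: continuous_integrable_itv.
by rewrite RintegralB//; [rewrite opprB addrC opprK|exact: continuous_integrable_itv..].
Qed.

Lemma oriented_int_cst k a b : oriented_int (fun=> k) a b = k * (b - a).
Proof.
have H x y : x <= y -> \int[mu]_(t in `[x, y]) k = k * (y - x).
  move=> xy; rewrite Rintegral_cst//= lebesgue_measure_itv/= lte_fin.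
  case: ltgtP xy => [xy _|//|-> _]; first by rewrite -EFinB.
  by rewrite subrr.
rewrite /oriented_int; case: (leP a b) => [ab|/ltW ba]; rewrite H//.
by rewrite -mulrN opprB.
Qed.

Lemma le_oriented_int f g a b : continuous f -> continuous g -> a <= b ->
  (forall t, a <= t <= b -> f t <= g t) ->
  oriented_int f a b <= oriented_int g a b.
Proof.
move=> cf cg ab fg; rewrite !oriented_int_le// le_Rintegral//;
  exact: continuous_integrable_itv.
Qed.

Lemma oriented_int_ge0 f a b : continuous f -> a <= b ->
  (forall t, a <= t <= b -> 0 <= f t) -> 0 <= oriented_int f a b.
Proof.
move=> cf ab f0; have c0 : continuous (fun _ : R => 0 : R).
  exact: cst_continuous.
by have := le_oriented_int c0 cf ab f0; rewrite oriented_int_cst mul0r.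
Qed.

Lemma ler_oriented_int f L a b : continuous f -> (forall t, `|f t| <= L) ->
  `|oriented_int f a b| <= L * `|b - a|.
Proof.
move=> cf fL; have cc (k : R) : continuous (fun _ : R => k) by exact: cst_continuous.
wlog ab : a b / a <= b.
  move=> W; case: (leP a b) => [|/ltW]; first exact: W.
  by rewrite oriented_intC normrN distrC; exact: W.
rewrite ler_norml (ger0_norm (_ : 0 <= b - a)) ?subr_ge0//.
rewrite -mulNr -!oriented_int_cst !le_oriented_int//.
  by move=> t _; have := fL t; rewrite ler_norml => /andP[].
by move=> t _; have := fL t; rewrite ler_norml => /andP[].
Qed.

Lemma oriented_intBr f a b : continuous f ->
  oriented_int f 0 b - oriented_int f 0 a = oriented_int f a b.
Proof. by move=> cf; rewrite -(oriented_int_chasles 0 a b)// addrAC subrr add0r. Qed.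

Lemma continuous_oriented_int f L : continuous f -> (forall t, `|f t| <= L) ->
  continuous (oriented_int f 0).
Proof.
move=> cf fL; apply: (@lipschitz_continuous _ _ _ L) => x y.
by rewrite oriented_intBr// ler_oriented_int.
Qed.

End oriented_integral.

(** * Linear growth of the primitive of an odd-like function *)

Section odd_coercive.
Context {R : realType}.
Implicit Types (h : R -> R) (c b : R).

(** The part of being odd and nondecreasing that makes a primitive grow linearly in both directions;
    [primG g] and [barG_odd g] share it, with c = [slope g]. *)
Definition coercive_slope c h := [/\ 0 <= c,
  forall t, 0 <= t -> 0 <= h t, forall t, t <= 0 -> h t <= 0,
  forall t, 1 <= t -> c <= h t & forall t, t <= -1 -> h t <= - c].

(** The unit interval next to 0 contributes a nonnegative amount and the rest at least c per unit
    length. The constant c lost this way later produces the integrable kernel of order n - 1 + s. *)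
Lemma oriented_int_coercive c h b : continuous h -> coercive_slope c h ->
  0 <= oriented_int h 0 b /\ c * (`|b| - 1) <= oriented_int h 0 b.
Proof.
move=> ch [c0 h0 h0' hc hc'].
have ck (k : R) : continuous (fun _ : R => k) by exact: cst_continuous.
case: (leP 0 b) => [b0|/ltW b0].
  have p1 : 0 <= oriented_int h 0 b.
    by apply: oriented_int_ge0 => // t /andP[t0 _]; exact: h0.
  split=> //; rewrite ger0_norm//; have [b1|/ltW b1] := leP b 1.
    by apply: le_trans p1; rewrite mulr_ge0_le0// subr_le0.
  rewrite -(oriented_int_chasles 0 1 b)//.
  have q1 : 0 <= oriented_int h 0 1.
    by apply: oriented_int_ge0 => // t /andP[t0 _]; exact: h0.
  have : oriented_int (fun=> c) 1 b <= oriented_int h 1 b.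
    by apply: le_oriented_int => // t /andP[t1 _]; exact: hc.
  by rewrite oriented_int_cst; lra.
rewrite oriented_intC ler0_norm//.
have p1 x : x <= 0 -> oriented_int h x 0 <= 0.
  move=> x0; apply: (@le_trans _ _ (oriented_int (fun _ : R => 0) x 0)).
    by apply: le_oriented_int => // t /andP[_ t0]; exact: h0'.
  by rewrite oriented_int_cst mul0r.
split; first by rewrite oppr_ge0 p1.
have [b1|/ltW b1] := leP (- b) 1.
  by have := p1 _ b0; have : c * (- b - 1) <= 0; [rewrite mulr_ge0_le0//; lra|lra].
have bm : b <= -1 by lra.
rewrite -(oriented_int_chasles b (-1) 0)//.
have : oriented_int h b (-1) <= oriented_int (fun=> - c) b (-1).
  by apply: le_oriented_int => // t /andP[_ t1]; exact: hc'.
have := p1 (-1); rewrite oriented_int_cst.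
by nra.
Qed.

End odd_coercive.

(** * The profile g, its primitives, and the cross interaction *)

Section profile.
Context {R : realType}.
Variable g : R -> R.
Hypothesis g_cont : continuous g.
Hypothesis g_gt0 : forall t : R, 0 < g t.
Hypothesis g_le1 : forall t : R, g t <= 1.
Hypothesis g_int : (\int[@lebesgue_measure R]_t (g t * `|t|)%:E < +oo)%E.
Local Notation mu := (@lebesgue_measure R).

Let mg : measurable_fun setT g.
Proof. exact: continuous_measurable_fun. Qed.

(** On [-1, 1] the bound g <= 1 applies, and outside g(t) is at most g(t)|t|. *)
Lemma integrable_profile : mu.-integrable setT (EFin \o g).
Proof.
apply/integrableP; split; first exact/measurable_EFinP.
have mI : measurable_fun setT (fun x : R => (\1_(`[-1, 1] : set R) x : R)%:E).
  by apply/measurable_EFinP; exact: measurable_indic.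
have mt : measurable_fun setT (fun t : R => (g t * `|t|)%:E).
  by apply/measurable_EFinP; apply: measurable_funM => //; exact: measurableT_comp.
apply: (@le_lt_trans _ _ (\int[mu]_t ((\1_(`[-1, 1] : set R) t : R)%:E + (g t * `|t|)%:E))%E).
  apply: ge0_le_integral => //.
  - apply: measurableT_comp => //; exact/measurable_EFinP.
  - exact: emeasurable_funD.
  - move=> t _; rewrite abse_EFin -EFinD lee_fin gtr0_norm// indicE.
    have [_|] := boolP (t \in _).
      by rewrite (le_trans (g_le1 t))// lerDl mulr_ge0// ltW.
    rewrite notin_setE /= in_itv /= => /negP; rewrite -ler_norml -ltNge add0r => t1.
    by rewrite ler_peMr// ltW.
rewrite ge0_integralD//.
- rewrite integral_indic// setIT lte_add_pinfty//.
  by rewrite /= lebesgue_measure_itv/= lte_fin; case: ifP => // _; rewrite ltry.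
- by move=> t _; rewrite lee_fin mulr_ge0// ltW.
Qed.

Definition mass : R := \int[mu]_t g t.

Lemma mass_ge0 : 0 <= mass.
Proof. by apply: Rintegral_ge0 => t _; rewrite ltW. Qed.

Let integrable_sub (D : set R) : measurable D -> mu.-integrable D (EFin \o g).
Proof. by move=> mD; apply: integrableS integrable_profile. Qed.

Lemma barG_ge0 t : 0 <= barG g t.
Proof. by apply: Rintegral_ge0 => x _; rewrite ltW. Qed.

Lemma barG_le_mass t : barG g t <= mass.
Proof.
rewrite /barG /mass /Rintegral fine_le//.
- exact: integrable_fin_num (integrable_sub _).
- exact: integrable_fin_num (integrable_sub _).
- apply: ge0_subset_integral => //; first exact/measurable_EFinP.
  by move=> x _; rewrite lee_fin ltW.
Qed.

Lemma barGB a b : barG g b - barG g a = oriented_int g a b.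
Proof.
wlog ab : a b / a <= b.
  move=> W; case: (leP a b) => [|/ltW]; first exact: W.
  by rewrite oriented_intC -opprB => ?; rewrite W.
rewrite oriented_int_le// /barG.
rewrite -(@Rintegral_itv_obnd_cbnd _ a); last exact: integrable_sub.
apply: Rintegral_itvB; rewrite ?bnd_simp//.
exact: integrable_sub.
Qed.

Let g_norm t : `|g t| <= 1.
Proof. by rewrite gtr0_norm. Qed.

Lemma continuous_barG : continuous (barG g).
Proof.
apply: (@lipschitz_continuous _ _ _ 1) => x y.
by rewrite barGB ler_oriented_int.
Qed.

Lemma continuous_barGN : continuous (fun t => barG g (- t)).
Proof.
apply: (@lipschitz_continuous _ _ _ 1) => x y.
rewrite barGB (le_trans (ler_oriented_int _ _ g_cont g_norm))//.
by rewrite opprK addrC distrC.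
Qed.

(** The function H of the overview; K is its oriented integral from 0. *)
Definition barG_odd t := barG g t - barG g (- t).

Lemma continuous_barG_odd : continuous barG_odd.
Proof.
by move=> t; apply: cvgB; [exact: continuous_barG|exact: continuous_barGN].
Qed.

Lemma barG_odd_norm t : `|barG_odd t| <= mass.
Proof.
rewrite /barG_odd ler_norml.
have := barG_ge0 t; have := barG_le_mass t.
by have := barG_ge0 (- t); have := barG_le_mass (- t); lra.
Qed.

Lemma continuous_primG : continuous (primG g).
Proof. exact: (@continuous_oriented_int _ _ 1). Qed.

Lemma primG_norm t : `|primG g t| <= mass.
Proof.
rewrite /primG -barGB ler_norml.
have := barG_ge0 t; have := barG_le_mass t.
by have := barG_ge0 0; have := barG_le_mass 0; lra.
Qed.

Let oint_gt0 a b : a < b -> 0 < oriented_int g a b.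
Proof.
move=> ab; have [m mab gm] := EVT_min (ltW ab) (continuous_subspaceT g_cont).
have : oriented_int (fun=> g m) a b <= oriented_int g a b.
  have cm : continuous (fun _ : R => g m) by exact: cst_continuous.
  apply: (le_oriented_int cm g_cont (ltW ab)) => t tab.
  by apply: gm; rewrite in_itv.
by apply: lt_le_trans; rewrite oriented_int_cst mulr_gt0// subr_gt0.
Qed.

Let oint_ge0 a b : a <= b -> 0 <= oriented_int g a b.
Proof. by move=> ab; apply: oriented_int_ge0 => // t _; rewrite ltW. Qed.

(** The growth of the primitive of g over the unit intervals on the two sides of 0, one for each
    direction in [coercive_slope]; for an even g both terms equal [primG g 1]. *)
Definition slope : R := Num.min (oriented_int g 0 1) (oriented_int g (-1) 0).

Lemma slope_gt0 : 0 < slope.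
Proof. by rewrite lt_min !oint_gt0//; lra. Qed.

Let slope_le1 : slope <= oriented_int g 0 1.
Proof. by rewrite ge_min lexx. Qed.

Let slope_le2 : slope <= oriented_int g (-1) 0.
Proof. by rewrite ge_min lexx orbT. Qed.

Let C a b c := @oriented_int_chasles R g a b c g_cont.

Lemma primG_slope : coercive_slope slope (primG g).
Proof.
rewrite /primG; split; first exact: ltW slope_gt0.
- by move=> t t0; exact: oint_ge0.
- by move=> t t0; rewrite oriented_intC oppr_le0 oint_ge0.
- by move=> t t1; have := C 0 1 t; have := oint_ge0 t1; have := slope_le1; lra.
- move=> t t1; have := C t (-1) 0; have := oint_ge0 t1.
  by have := slope_le2; rewrite (oriented_intC g 0 t); lra.
Qed.

(** [barG_odd g t] is the oriented integral of g from -t to t: for t >= 1 this interval contains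
    [0, 1], and for t <= -1 it is traversed backwards and contains [-1, 0]. *)
Lemma barG_odd_slope : coercive_slope slope barG_odd.
Proof.
rewrite /barG_odd; split; first exact: ltW slope_gt0.
- by move=> t t0; rewrite barGB oint_ge0//; lra.
- by move=> t t0; rewrite barGB oriented_intC oppr_le0 oint_ge0//; lra.
- move=> t t1; rewrite barGB -(C (- t) 0) -(C 0 1).
  by have := slope_le1; have := oint_ge0 t1; have := @oint_ge0 (- t) 0; lra.
- move=> t t1; rewrite barGB oriented_intC -(C t 0) -(C t (-1)).
  by have := slope_le2; have := oint_ge0 t1; have := @oint_ge0 0 (- t); lra.
Qed.

Definition crossG (a b c : R) : R :=
  oriented_int (barG g) a b + oriented_int (fun t => barG g (- t)) b c.

(** The derivative of [crossG] in its middle argument is [barG_odd], whatever the outer endpoints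
    are. As M occurs only in those, it disappears from the difference of the densities of N(u) and
    N(v). *)
Lemma crossG_shift a b b' c :
  crossG a b c =
  crossG a b' c + (oriented_int barG_odd 0 b - oriented_int barG_odd 0 b').
Proof.
rewrite oriented_intBr; last exact: continuous_barG_odd.
rewrite oriented_intB; [|exact: continuous_barG|exact: continuous_barGN].
rewrite /crossG.
rewrite -(oriented_int_chasles a b' b continuous_barG).
rewrite -(oriented_int_chasles b' b c continuous_barGN).
move: (oriented_int (barG g) a b') (oriented_int (barG g) b' b) => p q.
move: (oriented_int _ b c) (oriented_int _ b' b) => r t.
by lra.
Qed.

Lemma crossG_bounds a b c : a <= b -> b <= c ->
  0 <= crossG a b c <= mass * (c - a).
Proof.
move=> ab bc; rewrite /crossG.
have n1 t : `|barG g t| <= mass by rewrite ger0_norm ?barG_ge0 ?barG_le_mass.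
have u1 := le_trans (ler_norm _) (ler_oriented_int a b continuous_barG n1).
have u2 := le_trans (ler_norm _)
  (ler_oriented_int b c continuous_barGN (fun t => n1 (- t))).
have p1 : 0 <= oriented_int (barG g) a b.
  by apply: oriented_int_ge0 => //; [exact: continuous_barG|move=> t _; exact: barG_ge0].
have p2 : 0 <= oriented_int (fun t => barG g (- t)) b c.
  by apply: oriented_int_ge0 => //; [exact: continuous_barGN|move=> t _; exact: barG_ge0].
move: u1 u2 p1 p2; rewrite !(ger0_norm (_ : 0 <= _ - _)) ?subr_ge0//.
move: (oriented_int (barG g) a b) (oriented_int _ b c) => p q.
by lra.
Qed.

End profile.

(** * Cubes, their measure, and measurability of open sets *)

Section cubes.
Context {R : realType} {n : nat}.
Implicit Types (x y z : 'rV[R]_n) (r : R).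
Local Notation mu := (lebesgue_rV R n).

(** The ball of the sup norm, kept as a product of intervals so that its measure is explicit. *)
Definition cube x r : set 'rV[R]_n :=
  [set y | forall i, `|x ord0 i - y ord0 i| < r].

Lemma normrV_lt x r : 0 < r -> (`|x| < r <-> forall i, `|x ord0 i| < r).
Proof.
move=> r0; rewrite /Num.norm/= mx_normrE; split=> [/bigmax_ltP[_ H] i|H].
  exact: (H (ord0, i)).
by apply/bigmax_ltP; split=> // -[j i] _; rewrite (ord1 j); exact: H.
Qed.

Lemma cubeP x r y : 0 < r -> cube x r y <-> `|x - y| < r.
Proof.
move=> r0; rewrite /cube/= normrV_lt//; split=> H i; have := H i; by rewrite !mxE.
Qed.

Lemma normrV_coord x i : `|x ord0 i| <= `|x|.
Proof. by rewrite [leRHS]/Num.norm/= mx_normrE (le_bigmax _ _ (ord0, i)). Qed.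

Let cubeE x r : cube x r =
  [set y | forall i, (`]x ord0 i - r, x ord0 i + r[%classic : set (measurableTypeR R)) (y ord0 i)].
Proof.
by apply/seteqP; split=> y /= H i; have := H i; rewrite in_itv /= ltr_distlC.
Qed.

Lemma measurable_cube x r : measurable (cube x r).
Proof.
rewrite cubeE [X in measurable X](_ : _ = \big[setI/setT]_(i < n)
    ((fun y : 'rV[R]_n => y ord0 i) @^-1` `]x ord0 i - r, x ord0 i + r[)).
  apply: bigsetI_measurable => i _; rewrite -[X in measurable X]setTI.
  exact: (measurable_coord i measurableT).
rewrite -bigcap_seq; apply/seteqP; split=> y /= H i => [_|]; first exact: H.
by apply: H => /=; rewrite mem_index_enum.
Qed.

Lemma lebesgue_cube x r : 0 <= r -> mu (cube x r) = ((2 * r) ^+ n)%:E.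
Proof.
move=> r0; rewrite cubeE.
rewrite (@lebesgue_rV_box R n (fun i => `]x ord0 i - r, x ord0 i + r[%classic))//.
under eq_bigr => i _.
  rewrite /= lebesgue_measure_itv/= lte_fin.
  over.
rewrite (eq_bigr (fun=> (2 * r)%:E)) => [|i _].
  by rewrite -(big_morph EFin EFinM (erefl _)) prodr_const card_ord.
case: ifPn => [_|]; first by rewrite -EFinB; congr (_%:E); lra.
by rewrite -leNgt => h; congr (_%:E); lra.
Qed.

(** The sigma-algebra is generated by the coordinates, so U is written as the countable union of the
    cubes contained in it that have a rational centre and half-side 1/(j+1). *)
Lemma open_measurable_rV (U : set 'rV[R]_n) : open U -> measurable U.
Proof.
move=> oU.
pose Q (p : 'rV[rat]_n * nat) := cube (map_mx ratr p.1) p.2.+1%:R^-1.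
pose F k := if unpickle k is Some p then
  if pselect (Q p `<=` U) then Q p else set0 else set0.
rewrite (_ : U = \bigcup_k F k).
  apply: bigcup_measurable => k _; rewrite /F; case: (unpickle k) => [p|]; last exact: measurable0.
  case: (pselect _) => H; [exact: measurable_cube|exact: measurable0].
apply/seteqP; split=> [x Ux|x [k _]]; last first.
  rewrite /F; case: (unpickle k) => [p|//]; case: (pselect _) => [pU /pU|] //.
have /nbhs_normP[/= e e0 eU] : nbhs x U by exact: open_nbhs_nbhs.
(* Half of e: a cube of half-side below e / 2 that contains x stays in the ball of radius e around
   x. *)
have [j _ je] : exists2 j : nat, True & j.+1%:R^-1 < e / 2.
  have e20 : 0 < e / 2 by rewrite divr_gt0.
  exists (Num.truncn (e / 2)^-1) => //.
  by rewrite invf_plt ?posrE// truncnS_gt.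
have j0 : 0 < j.+1%:R^-1 :> R by rewrite invr_gt0.
have [q qx] : exists q : 'rV[rat]_n, forall i, `|ratr (q ord0 i) - x ord0 i| < j.+1%:R^-1.
  have /choice[f fx] : forall i, exists q : rat, `|ratr q - x ord0 i| < j.+1%:R^-1.
    move=> i; have : x ord0 i - j.+1%:R^-1 < x ord0 i + j.+1%:R^-1.
      by rewrite ltrBlDr -addrA ltrDl addr_gt0.
    move=> /rat_in_itvoo[q]; rewrite in_itv/= => qx.
    by exists q; rewrite distrC ltr_distlC.
  by exists (\row_i f i) => i; rewrite mxE.
have Qx : Q (q, j) x by move=> i; rewrite mxE; exact: qx.
exists (pickle (q, j)) => //; rewrite /F pickleK; case: (pselect _) => [//|[]].
move=> y /= Qy; apply: eU => /=; apply/normrV_lt => // i.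
have := Qy i; have := Qx i; rewrite !mxE /= => h1 h2.
rewrite (_ : x ord0 i - y ord0 i =
  (ratr (q ord0 i) - y ord0 i) - (ratr (q ord0 i) - x ord0 i)); last by lra.
apply: le_lt_trans (ler_normB _ _) _; rewrite [ltRHS]splitr.
by apply: ltrD; [exact: lt_trans h2 je|exact: lt_trans h1 je].
Qed.

End cubes.

(** * The Euclidean norm against the sup norm *)

Section euclidean_norm.
Context {R : realType} {n : nat}.
Implicit Types (x y z : 'rV[R]_n) (r : R).

Lemma enorm_ge0 x : 0 <= enorm x.
Proof. exact: sqrtr_ge0. Qed.

Lemma enormN x : enorm (- x) = enorm x.
Proof.
by rewrite /enorm; congr Num.sqrt; apply: eq_bigr => i _; rewrite mxE sqrrN.
Qed.

Lemma enormC x y : enorm (x - y) = enorm (y - x).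
Proof. by rewrite -enormN opprB. Qed.

Lemma enorm_coord x i : `|x ord0 i| <= enorm x.
Proof.
rewrite -sqrtr_sqr /enorm ler_sqrt ?sumr_ge0//; last by move=> j _; exact: sqr_ge0.
by rewrite (bigD1 i)//= lerDl sumr_ge0// => j _; exact: sqr_ge0.
Qed.

Lemma normrV_le_enorm x : `|x| <= enorm x.
Proof.
rewrite /Num.norm/= mx_normrE; apply/bigmax_leP; split; first exact: enorm_ge0.
by move=> [j i] _; rewrite (ord1 j); exact: enorm_coord.
Qed.

(** The crude factor n, rather than its square root, is enough; it is the origin of the powers of n
    in the constants. *)
Lemma enorm_le_normrV x : enorm x <= n%:R * `|x|.
Proof.
rewrite -[leRHS]ger0_norm ?mulr_ge0// -sqrtr_sqr /enorm ler_sqrt ?sqr_ge0//.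
apply: (@le_trans _ _ (\sum_(i < n) `|x| ^+ 2)).
  apply: ler_sum => i _; rewrite -real_normK ?num_real// lerXn2r ?nnegrE//.
  exact: normrV_coord.
rewrite sumr_const card_ord exprMn -[leLHS]mulr_natl ler_wpM2r ?sqr_ge0//.
by rewrite -natrX ler_nat; case: n => // m; rewrite expnS leq_pmulr// expn_gt0.
Qed.

Lemma enorm_eq0 x y : enorm (x - y) = 0 -> x = y.
Proof.
move=> h; apply/eqP; rewrite -subr_eq0 -normr_eq0 eq_le normr_ge0 andbT.
by rewrite -h normrV_le_enorm.
Qed.

Lemma enorm0 : enorm (0 : 'rV[R]_n) = 0.
Proof.
by rewrite /enorm big1 ?sqrtr0// => i _; rewrite mxE expr0n.
Qed.

Lemma enorm_gt0 x y : x <> y -> 0 < enorm (x - y).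
Proof.
move=> xy; rewrite lt_neqAle enorm_ge0 andbT eq_sym; apply/eqP.
by move=> /enorm_eq0.
Qed.

Lemma diam_ge (Om : set 'rV[R]_n) x y :
  bounded_set Om -> Om x -> Om y -> enorm (x - y) <= diam Om.
Proof.
move=> [M [_ bM]] Ox Oy; rewrite /diam; apply: ub_le_sup; last first.
  by exists x => //; exists y.
exists (n%:R * ((M + 1) + (M + 1))) => _ [u Ou [v Ov <-]].
apply: le_trans (enorm_le_normrV _) _; rewrite ler_wpM2l//.
by rewrite (le_trans (ler_normB _ _))// lerD// bM ?ltrDl.
Qed.

End euclidean_norm.

(** * Integrals of the kernel |x - y|^(-p) near the diagonal and at infinity *)

Section kernel_integrals.
Context {R : realType} {n : nat}.
Implicit Types (x y : 'rV[R]_n) (p r : R).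
Local Notation mu := (lebesgue_rV R n).

Definition kernel p x y : R := (enorm (x - y) `^ p)^-1.

Lemma kernel_ge0 p x y : 0 <= kernel p x y.
Proof. by rewrite /kernel invr_ge0 powR_ge0. Qed.

Lemma powR_exprn (a r : R) k : 0 <= a -> (a ^+ k) `^ r = (a `^ r) ^+ k.
Proof.
move=> a0; elim: k => [|k IH]; first by rewrite !expr0 powR1.
by rewrite !exprS powRM ?exprn_ge0// IH.
Qed.

Let shell_weight (rho t c e p : R) : 0 < rho -> 0 < t -> 0 < c ->
  ((rho * t * c) `^ p)^-1 * (2 * (rho * t * e)) ^+ n =
  c `^ (- p) * (2 * e) ^+ n * rho `^ (n%:R - p) * t `^ (n%:R - p).
Proof.
move=> r0 t0 c0; rewrite -powRN !powRM ?ltW ?mulr_gt0//.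
rewrite !powRD ?(gt_eqF r0) ?(gt_eqF t0) ?implybT//
  !powR_mulrn ?ltW// !exprMn.
by ring.
Qed.

(** On the k-th shell the kernel is at most (rho b^k c)^(-p) and the measure at most (2 rho b^k
    e)^n, whence a geometric series of ratio b^(n - p). It converges for b = 1/2 when p < n and for
    b = 2 when p > n. *)
Lemma kernel_shells (D : set 'rV[R]_n) x (rho b c e p : R) :
    measurable D -> 0 < rho -> 0 < b -> 0 < c -> 0 < e -> 0 < p ->
    b `^ (n%:R - p) < 1 ->
    (forall y, D y -> x <> y ->
      exists k, rho * b ^+ k * c <= `|x - y| < rho * b ^+ k * e) ->
  (\int[mu]_(y in D) (kernel p x y)%:E <=
   (c `^ (- p) * (2 * e) ^+ n * rho `^ (n%:R - p) / (1 - b `^ (n%:R - p)))%:E)%E.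
Proof.
move=> mD r0 b0 c0 e0 p0 z1 shells.
have rb0 k : 0 < rho * b ^+ k by rewrite mulr_gt0 ?exprn_gt0.
pose E k := cube x (rho * b ^+ k * e) `\` cube x (rho * b ^+ k * c).
have mE k : measurable (E k) by apply: measurableD; exact: measurable_cube.
apply: (@integral_geometric_cover _ _ _ mu D E
  (fun k => ((rho * b ^+ k * c) `^ p)^-1)) => //.
- move=> y Dy ky.
  (* With the default values of powers and inverses at 0 the kernel vanishes at y = x, so no shell
     has to contain x. *)
  have xy : x <> y.
    move=> xy; move: ky; rewrite xy /kernel subrr enorm0.
    by rewrite powR0 ?gt_eqF// invr0 ltxx.
  have [k /andP[h1 h2]] := shells _ Dy xy; exists k; split.
    by apply/cubeP => //; rewrite mulr_gt0.
  by move/cubeP; rewrite mulr_gt0// => /(_ isT); rewrite ltNge h1.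
- by move=> y _; rewrite lee_fin kernel_ge0.
- by move=> k; rewrite invr_ge0 powR_ge0.
- move=> k y Dy [_ ny]; rewrite lee_fin /kernel lef_pV2 ?posrE ?powR_gt0//.
  + apply: ge0_ler_powR; rewrite ?nnegrE ?enorm_ge0 ?(ltW p0) ?(ltW (mulr_gt0 (rb0 k) c0))//.
    rewrite (le_trans _ (normrV_le_enorm _))// leNgt; apply/negP => h.
    by apply: ny; apply/cubeP => //; rewrite mulr_gt0.
  + apply: enorm_gt0 => xy; apply: ny; rewrite xy => i.
    by rewrite subrr normr0 mulr_gt0.
  + by rewrite mulr_gt0.
- by rewrite !mulr_ge0 ?exprn_ge0 ?powR_ge0 ?mulr_ge0// ltW.
- by rewrite powR_gt0.
- move=> k; rewrite -powR_exprn ?(ltW b0)//.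
  apply: (@le_trans _ _ ((((rho * b ^+ k * c) `^ p)^-1)%:E *
      ((2 * (rho * b ^+ k * e)) ^+ n)%:E)%E); last first.
    by rewrite -EFinM shell_weight ?exprn_gt0.
  apply: lee_wpmul2l; first by rewrite lee_fin invr_ge0 powR_ge0.
  rewrite -(lebesgue_cube x) ?(ltW (mulr_gt0 (rb0 k) e0))//.
  apply: le_measure; [by rewrite inE|by rewrite inE; exact: measurable_cube|].
  by move=> y [].
Qed.

Lemma exists_dyadic_below (t rho : R) : 0 < t -> t < rho ->
  exists k, rho * 2^-1 ^+ k * 2^-1 <= t < rho * 2^-1 ^+ k * 1.
Proof.
move=> t0 tr; have r0 : 0 < rho by exact: lt_trans tr.
have ex : exists k, rho * 2^-1 ^+ k <= t.
  have : @GRing.exp R 2^-1 @ \oo --> (0 : R).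
    by apply: cvg_expr; rewrite ger0_norm// invf_lt1// ltr1n.
  move=> /cvgrPdist_lt/(_ (t / rho)); rewrite divr_gt0// => /(_ isT)[k _ /(_ k (leqnn k))].
  rewrite /= sub0r normrN ger0_norm ?exprn_ge0// => h; exists k.
  by rewrite mulrC -ler_pdivlMr// ltW.
case: (ex_minnP ex) => -[|k] hk kmin.
  by move: hk; rewrite expr0 mulr1 leNgt tr.
exists k; rewrite -mulrA -exprSr hk mulr1 ltNge; apply/negP => /kmin.
by rewrite ltnn.
Qed.

Lemma exists_dyadic_above (t rho : R) : 0 < rho -> rho <= t ->
  exists k, rho * 2 ^+ k * 1 <= t < rho * 2 ^+ k * 2.
Proof.
move=> r0 rt.
have ex : exists k, t < rho * 2 ^+ k.
  exists (Num.truncn (t / rho)).+1; rewrite mulrC -ltr_pdivrMr//.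
  rewrite (lt_trans (truncnS_gt _))// -natrX ltr_nat.
  exact: ltn_expl.
case: (ex_minnP ex) => -[|k] hk kmin.
  by move: hk; rewrite expr0 mulr1 ltNge rt.
exists k; rewrite -[_ * 2]mulrA -exprSr hk mulr1 andbT leNgt; apply/negP => /kmin.
by rewrite ltnn.
Qed.

(** The constant of [kernel_shells] for b = c = 1/2 and e = 1; [far_cst] is the one for b = 2, c = 1
    and e = 2. *)
Definition near_cst p : R := (2^-1) `^ (- p) * 2 ^+ n / (1 - 2^-1 `^ (n%:R - p)).

Definition far_cst p : R := 4 ^+ n / (1 - 2 `^ (n%:R - p)).

Lemma powR_lt1 (b r : R) : 0 < b < 1 -> 0 < r -> b `^ r < 1.
Proof.
move=> /andP[b0 b1] r0; rewrite [ltRHS](_ : 1 = 1 `^ r); last by rewrite powR1.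
by apply: gt0_ltr_powR; rewrite ?nnegrE ?ltW.
Qed.

Let half1 : 0 < (2^-1 : R) < 1.
Proof. by rewrite invr_gt0 ltr0n invf_lt1// ltr1n. Qed.

Lemma pow2_lt1 (r : R) : r < 0 -> 2 `^ r < 1.
Proof.
move=> r0; rewrite -(opprK r) powRN invf_lt1 ?powR_gt0//.
rewrite [ltLHS](_ : 1 = 1 `^ (- r)); last by rewrite powR1.
apply: gt0_ltr_powR; rewrite ?nnegrE ?ltr1n//.
by rewrite oppr_gt0.
Qed.

Lemma near_cst_gt0 p : 0 < p < n%:R -> 0 < near_cst p.
Proof.
move=> /andP[p0 pn]; rewrite divr_gt0// ?mulr_gt0 ?powR_gt0 ?exprn_gt0//.
by rewrite subr_gt0 powR_lt1// subr_gt0.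
Qed.

Lemma far_cst_gt0 p : n%:R < p -> 0 < far_cst p.
Proof.
by move=> pn; rewrite divr_gt0 ?exprn_gt0// subr_gt0 pow2_lt1// subr_lt0.
Qed.

Lemma kernel_near p x r : 0 < r -> 0 < p < n%:R ->
  (\int[mu]_(y in cube x r) (kernel p x y)%:E <=
   (near_cst p * r `^ (n%:R - p))%:E)%E.
Proof.
move=> r0 /andP[p0 pn].
have z1 : 2^-1 `^ (n%:R - p) < 1 :> R by rewrite powR_lt1// subr_gt0.
have := @kernel_shells (cube x r) x r 2^-1 2^-1 1 p (measurable_cube _ _) r0.
rewrite invr_gt0 ltr0n => /(_ isT isT ltr01 p0 z1) H.
apply: le_trans (H _) _.
  move=> y /cubeP; rewrite r0 => /(_ isT) yr xy.
  by apply: exists_dyadic_below => //; rewrite normr_gt0 subr_eq0; exact/eqP.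
by rewrite lee_fin /near_cst mulr1 mulrAC.
Qed.

Lemma kernel_far p x r (D : set 'rV[R]_n) : measurable D -> 0 < r -> n%:R < p ->
  (forall y, D y -> r <= `|x - y|) ->
  (\int[mu]_(y in D) (kernel p x y)%:E <= (far_cst p * r `^ (n%:R - p))%:E)%E.
Proof.
move=> mD r0 pn Dr; have p0 : 0 < p by rewrite (le_lt_trans _ pn).
have z1 : 2 `^ (n%:R - p) < 1 :> R by rewrite pow2_lt1// subr_lt0.
have := @kernel_shells D x r 2 1 2 p mD r0.
rewrite ltr0n ltr01 => /(_ isT isT isT p0 z1) H.
apply: le_trans (H _) _.
  by move=> y Dy xy; apply: exists_dyadic_above => //; exact: Dr.
rewrite lee_fin /far_cst powR1 mul1r -natrM.
by rewrite -mulrA (mulrC (_ `^ _)) mulrA.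
Qed.

End kernel_integrals.

(** * Translation invariance of the n-dimensional Lebesgue measure *)

Section translation.
Context {R : realType}.

Lemma lebesgue_measure_shift (h : R) (A : set (measurableTypeR R)) :
  measurable A ->
  lebesgue_measure [set x | A (x + h)] = lebesgue_measure A.
Proof.
move=> mA.
have mh : measurable_fun setT (fun x : measurableTypeR R => x + h : measurableTypeR R).
  by apply: measurable_funD.
pose nu := pushforward (@lebesgue_measure R)
  (fun x : measurableTypeR R => x + h : measurableTypeR R).
rewrite -[LHS]/(nu A).
apply/esym; apply: (lebesgue_measure_unique _ mA) => //.
move=> _ [[a b]] _ <-; rewrite /nu /pushforward /=.
rewrite [X in _ = lebesgue_measure X](_ : _ = `]a - h, b - h]%classic).
  by rewrite !lebesgue_measure_itv/= !lte_fin ltrBlDr subrK; case: ifP => // _; congr (_%:E); lra.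
by apply/seteqP; split=> x /=; rewrite !in_itv/= ltrBlDr lerBrDr.
Qed.

(** By induction on the dimension: [row_cons] intertwines the shift by h with a product S of shifts,
    and the image measure under S is the product measure because it has the right values on
    rectangles. *)
Lemma lebesgue_rV_shift n (h : 'rV[R]_n) (A : set 'rV[R]_n) :
  measurable A -> lebesgue_rV R n [set x | A (x + h)] = lebesgue_rV R n A.
Proof.
elim: n h A => [|n IH] h A mA.
  by congr (_ _); apply/seteqP; split=> x /=; rewrite (_ : x + h = x)//; apply/rowP => -[].
rewrite /= /lebesgue_step /pushforward /=.
pose h0 := h ord0 ord0; pose h' : 'rV[R]_n := \row_i h ord0 (lift ord0 i).
pose S (p : measurableTypeR R * 'rV[R]_n) : measurableTypeR R * 'rV[R]_n :=
  (p.1 + h0 : measurableTypeR R, p.2 + h').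
have mS : measurable_fun setT S.
  apply/measurable_fun_pairP; split.
    exact: measurable_funD.
  apply/measurable_fun_coordP => i; under eq_fun do rewrite /= mxE.
  apply: measurable_funD => //.
  by apply: (measurableT_comp (measurable_coord i)).
have mA' : measurable (@row_cons R n @^-1` A).
  by rewrite -[X in measurable X]setTI; exact: measurable_row_cons.
rewrite [X in (_ \x _)%E X](_ : _ = S @^-1` (@row_cons R n @^-1` A)); last first.
  apply/seteqP; split=> p /=; rewrite (_ : row_cons p + h = row_cons (S p))//;
  by apply/rowP => i; rewrite !mxE; case: unliftP => [j|] ->; rewrite ?mxE.
pose nu := pushforward (@lebesgue_measure R \x lebesgue_rV R n)%E S.
rewrite -[LHS]/(nu (@row_cons R n @^-1` A)).
apply/esym; apply: (product_measure_unique _ mA') => //.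
move=> B C mB mC; rewrite /nu /pushforward.
rewrite /= /pushforward.
rewrite [X in product_measure1 _ _ X](_ : _ = [set x | B (x + h0)] `*` [set x | C (x + h')])//.
have mB' : measurable [set x : measurableTypeR R | B (x + h0)].
  rewrite -[X in measurable X]setTI.
  have : measurable_fun setT (fun x : measurableTypeR R => x + h0 : measurableTypeR R).
    by apply: measurable_funD.
  exact.
have mC' : measurable [set x : 'rV[R]_n | C (x + h')].
  rewrite -[X in measurable X]setTI.
  have : measurable_fun setT (fun x : 'rV[R]_n => x + h').
    apply/measurable_fun_coordP => i; under eq_fun do rewrite mxE.
    by apply: measurable_funD => //; exact: measurable_coord.
  exact.
rewrite product_measure1E//; congr (_ * _)%E; last exact: IH.
exact: lebesgue_measure_shift.
Qed.

End translation.

(** * Measure of a strip of small height *)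

Section strips.
Context {R : realType} {n : nat}.
Local Notation mu := (lebesgue_rV R n).

(* The 2 ^ k disjoint translates of the strip by multiples of w * e have the
   same measure and stay in one fixed cube. *)
Lemma lebesgue_strip (t : 'rV[R]_n -> R) (e x0 : 'rV[R]_n) (r B : R) (k : nat) :
    continuous t -> (forall x l, t (x + l *: e) = t x + l) -> 0 < r -> 0 < B ->
  (mu (cube x0 r `&` [set x | (B * 2^-1 ^+ k) / 2 <= t x < B * 2^-1 ^+ k]%R) <=
   ((2 * (r + B * `|e|)) ^+ n * 2^-1 ^+ k)%:E)%E.
Proof.
move=> ct te r0 B0; set w := B * 2^-1 ^+ k; set E := _ `&` _.
have w0 : 0 < w by rewrite mulr_gt0 ?exprn_gt0.
have mlt a : measurable [set x | t x < a].
  apply: open_measurable_rV; rewrite (_ : [set x | _] = t @^-1` `]-oo, a[).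
    by apply: (@open_comp _ _ t) => [x _|]; [exact: ct|exact: interval_open].
  by apply/seteqP; split=> x /=; rewrite in_itv.
have mE : measurable E.
  rewrite /E (_ : [set x | _] = [set x | t x < w] `\` [set x | t x < w / 2]).
    by apply: measurableI; [exact: measurable_cube|exact: measurableD].
  apply/seteqP; split=> x /= => [/andP[h1 h2]|[h2 /negP]].
    by split=> //; apply/negP; rewrite -leNgt.
  by rewrite -leNgt => ->.
pose F (j : nat) := [set x | E (x + (- (j%:R * w)) *: e)].
have muF j : mu (F j) = mu E by exact: lebesgue_rV_shift.
have mF j : measurable (F j).
  rewrite -[X in measurable X]setTI.
  have : measurable_fun setT (fun x : 'rV[R]_n => x + (- (j%:R * w)) *: e).
    apply/measurable_fun_coordP => i; under eq_fun do rewrite mxE.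
    by apply: measurable_funD => //; exact: measurable_coord.
  exact.
have tF : trivIset setT F.
  apply/trivIsetP => i j _ _ ij; apply/seteqP; split=> // x /= [].
  rewrite /F /E /= => -[_ /andP[a1 a2]] [_ /andP[b1 b2]].
  move: a1 a2 b1 b2; rewrite !te.
  wlog lij : i j ij / (i < j)%N => [W a1 a2 b1 b2|a1 a2 b1 b2].
    move: (ij); rewrite neq_ltn => /orP[|] h; first exact: (W i j).
    by apply: (W j i) => //; rewrite eq_sym.
  have : i.+1%:R * w <= j%:R * w by rewrite ler_pM2r// ler_nat.
  by rewrite -natr1 mulrDl mul1r; lra.
have e0 : 0 <= `|e| by [].
(* Fewer than 2^k steps of length w = B 2^(-k) move a point by at most B |e|, independently of k. *)
have Fsub j : (j < 2 ^ k)%N -> F j `<=` cube x0 (r + B * `|e|).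
  move=> jk x [/cubeP + _]; rewrite r0 => /(_ isT) h.
  apply/cubeP; first by rewrite ltr_wpDr// mulr_ge0// ltW.
  rewrite (_ : x0 - x = x0 - (x + (- (j%:R * w)) *: e) + (- (j%:R * w)) *: e); last first.
    by rewrite opprD addrA subrK.
  rewrite (le_lt_trans (ler_normD _ _))// ltr_leD// normrZ normrN.
  have jw0 : 0 <= j%:R * w by apply: mulr_ge0 => //; exact: ltW.
  rewrite (ger0_norm jw0) ler_wpM2r//.
  rewrite /w mulrCA ler_piMr ?(ltW B0)// exprVn ler_pdivrMr ?exprn_gt0// mul1r.
  by rewrite -natrX ler_nat ltnW.
have : (mu (\big[setU/set0]_(j < 2 ^ k) F j) <= mu (cube x0 (r + B * `|e|)))%E.
  apply: le_measure; rewrite ?inE.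
  - exact: bigsetU_measurable.
  - exact: measurable_cube.
  - rewrite -bigcup_mkord; apply: bigcup_sub => j /= jk; exact: Fsub.
rewrite measure_semi_additive_ord_I//; last 2 first.
- exact: sub_trivIset tF.
- exact: bigsetU_measurable.
rewrite lebesgue_cube; last by rewrite addr_ge0 ?mulr_ge0 ?(ltW r0) ?(ltW B0).
have muE : mu E \is a fin_num.
  rewrite ge0_fin_numE// (@le_lt_trans _ _ (mu (cube x0 r)))//.
    apply: le_measure; rewrite ?inE//; first exact: measurable_cube.
    exact: subIsetl.
  by rewrite lebesgue_cube ?(ltW r0)// ltry.
rewrite (eq_bigr (fun=> (fine (mu E))%:E)) => [|i _]; last first.
  by rewrite fineK//; exact: muF.
rewrite -(fineK muE) sumEFin sumr_const card_ord !lee_fin => h.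
by rewrite exprVn ler_pdivlMr ?exprn_gt0// -natrX mulr_natr.
Qed.

End strips.

(** * Measurability of parametric integrals and of the kernel *)

Section parametric_integral.
Local Open Scope ereal_scope.
Context d1 d2 (T1 : measurableType d1) (T2 : measurableType d2) (R : realType).
Variable m2 : {sigma_finite_measure set T2 -> \bar R}.

Lemma measurable_ge0_integral_param (D : set T2) (f : T1 * T2 -> \bar R) :
    measurable D -> measurable_fun setT f -> (forall z, 0 <= f z) ->
  measurable_fun setT (fun x => \int[m2]_(y in D) f (x, y)).
Proof.
move=> mD mf f0.
have mTD : measurable ([set: T1] `*` D) by exact: measurableX.
have := @measurable_fun_fubini_tonelli_F _ _ T1 T2 R m2 (f \_ ([set: T1] `*` D)).
rewrite /fubini_F => H.
rewrite (_ : (fun x => _) = fun x => \int[m2]_y (f \_ ([set: T1] `*` D)) (x, y)).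
  apply: H.
    by apply/(measurable_restrictT f mTD); exact: measurable_funTS.
  by move=> z; rewrite patchE; case: ifP.
apply/funext => x; rewrite integral_mkcond; apply: eq_integral => y _.
rewrite !patchE /=; congr (if _ then _ else _).
by apply/idP/idP => [/set_mem Dy|/set_mem [_ Dy]]; apply/mem_set.
Qed.

Lemma measurable_integral_param (D : set T2) (f : T1 * T2 -> \bar R) :
    measurable D -> measurable_fun setT f ->
  measurable_fun setT (fun x => \int[m2]_(y in D) f (x, y)).
Proof.
move=> mD mf.
have mp := measurable_ge0_integral_param mD (measurable_funepos mf) (funepos_ge0 f).
have mn := measurable_ge0_integral_param mD (measurable_funeneg mf) (funeneg_ge0 f).
rewrite (_ : (fun x => _) = (fun x =>
    \int[m2]_(y in D) f^\+ (x, y) - \int[m2]_(y in D) f^\- (x, y))).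
  exact: emeasurable_funB.
by apply/funext => x; rewrite integralE; congr (_ - _);
  apply: eq_integral => y _; rewrite ?funeposE ?funenegE.
Qed.

Lemma ge0_integral_setU_lty (A B : set T2) (f : T2 -> \bar R) :
    measurable A -> measurable B -> measurable_fun setT f -> (forall x, 0 <= f x) ->
    \int[m2]_(x in A) f x < +oo -> \int[m2]_(x in B) f x < +oo ->
  \int[m2]_(x in A `|` B) f x < +oo.
Proof.
move=> mA mB mf f0 Aoo Boo; rewrite -(setDUK (@subsetUl _ A B)) setDUl setDv set0U.
rewrite ge0_integral_setU//; last 3 first.
- exact: measurableD.
- exact: measurable_funTS.
- by apply/disj_set2P; rewrite setDE setICA setICr setI0.
rewrite lte_add_pinfty// (le_lt_trans _ Boo)//.
apply: ge0_subset_integral => //; first exact: measurableD.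
exact: measurable_funTS.
Qed.

End parametric_integral.

Section measurable_kernel.
Context {R : realType} {n : nat}.
Local Notation mu := (lebesgue_rV R n).

Lemma measurable_enormB :
  measurable_fun setT (fun z : 'rV[R]_n * 'rV[R]_n => enorm (z.1 - z.2)).
Proof.
rewrite (_ : (fun z => _) = (@powR R ^~ 2^-1) \o
    (fun z : 'rV[R]_n * 'rV[R]_n => \sum_(i < n) (z.1 ord0 i - z.2 ord0 i) ^+ 2)).
  apply: measurableT_comp; first exact: measurable_powR.
  apply: measurable_sum => i; apply: measurable_funX; apply: measurable_funB.
    by apply: (measurableT_comp (measurable_coord i)).
  by apply: (measurableT_comp (measurable_coord i)).
apply/funext => z; rewrite /= powR12_sqrt; last first.
  by rewrite sumr_ge0// => i _; rewrite sqr_ge0.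
by congr Num.sqrt; apply: eq_bigr => i _; rewrite !mxE.
Qed.

Lemma kernelE p (x y : 'rV[R]_n) : kernel p x y = enorm (x - y) `^ (- p).
Proof. by rewrite /kernel powRN. Qed.

Lemma measurable_kernel p :
  measurable_fun setT (fun z : 'rV[R]_n * 'rV[R]_n => kernel p z.1 z.2).
Proof.
under eq_fun do rewrite kernelE.
apply: (measurableT_comp (@measurable_powR R (- p))).
exact: measurable_enormB.
Qed.

Lemma measurable_kernelr p (x : 'rV[R]_n) : measurable_fun setT (kernel p x).
Proof.
apply: (measurableT_comp (measurable_kernel p) (measurable_pair1 x)).
Qed.

End measurable_kernel.

(** * The exit rate and its integral over layers along the boundary *)

Section perimeter.
Context {R : realType} {n : nat}.
Variables (s : R) (Om : set 'rV[R]_n).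
Hypothesis (s0 : 0 < s) (s1 : s < 1) (oOm : open Om).
Local Notation mu := (lebesgue_rV R n).

(* Its integral over Om is the fractional s-perimeter of Om. *)
Definition exit_rate (x : 'rV[R]_n) : \bar R :=
  (\int[mu]_(y in ~` Om) (kernel (n%:R + s) x y)%:E)%E.

Let mOm : measurable Om. Proof. exact: open_measurable_rV. Qed.

Lemma exit_rate_ge0 x : (0 <= exit_rate x)%E.
Proof. by apply: integral_ge0 => y _; rewrite lee_fin kernel_ge0. Qed.

Lemma measurable_exit_rate : measurable_fun setT exit_rate.
Proof.
apply: (@measurable_ge0_integral_param _ _ _ _ _ mu (~` Om)
  (fun z => (kernel (n%:R + s) z.1 z.2)%:E)).
- exact: measurableC.
- by apply/measurable_EFinP; exact: measurable_kernel.
- by move=> z; rewrite lee_fin kernel_ge0.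
Qed.

Lemma exit_rate_le x r : 0 < r -> (forall y, ~ Om y -> r <= `|x - y|) ->
  (exit_rate x <= (@far_cst R n (n%:R + s) * r `^ (- s))%:E)%E.
Proof.
move=> r0 Hr; have ns : n%:R < n%:R + s by rewrite ltrDl.
have := @kernel_far R n (n%:R + s) x r (~` Om) (measurableC mOm) r0 ns Hr.
by rewrite opprD addrA subrr add0r.
Qed.

(** The function t stands for the height over the boundary. Where it is of size T r 2^(-k), the
    complement is at distance at least r 2^(-k) / 2, so the exit rate is of order 2^(k s), while
    such a strip has measure of order 2^(-k). The sum has ratio 2^(s - 1), and this is where s < 1
    matters. *)
Lemma exit_rate_strip_lty (t : 'rV[R]_n -> R) (e x0 : 'rV[R]_n) (r T : R) :
    continuous t -> (forall x l, t (x + l *: e) = t x + l) -> 0 < r -> 0 < T ->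
    (forall x, cube x0 r x -> Om x -> 0 < t x < T * r) ->
    (forall x y, cube x0 r x -> Om x -> ~ Om y -> t x <= T * `|x - y|) ->
  (\int[mu]_(x in Om `&` cube x0 r) exit_rate x < +oo)%E.
Proof.
move=> ct te r0 T0 tB tT; set B := T * r.
have B0 : 0 < B by rewrite mulr_gt0.
pose E k := cube x0 r `&` [set x | (B * 2^-1 ^+ k) / 2 <= t x < B * 2^-1 ^+ k]%R.
have mlt a : measurable [set x | t x < a].
  apply: open_measurable_rV; rewrite (_ : [set x | _] = t @^-1` `]-oo, a[).
    by apply: (@open_comp _ _ t) => [x _|]; [exact: ct|exact: interval_open].
  by apply/seteqP; split=> x /=; rewrite in_itv.
have mE k : measurable (E k).
  rewrite /E (_ : [set x | _] = [set x | t x < (B * 2^-1 ^+ k)] `\`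
      [set x | t x < (B * 2^-1 ^+ k) / 2]).
    by apply: measurableI; [exact: measurable_cube|exact: measurableD].
  apply/seteqP; split=> x /= => [/andP[h1 h2]|[h2 /negP]].
    by split=> //; apply/negP; rewrite -leNgt.
  by rewrite -leNgt => ->.
have h0 : 0 < (2^-1 : R) by rewrite invr_gt0.
have f0 : 0 <= @far_cst R n (n%:R + s) by apply/ltW/far_cst_gt0; rewrite ltrDl.
have rk k : 0 < r * 2^-1 ^+ k * 2^-1 by rewrite !mulr_gt0 ?exprn_gt0.
pose V := (2 * (r + B * `|e|)) ^+ n.
have V0 : 0 <= V.
  by rewrite exprn_ge0// mulr_ge0// addr_ge0 ?mulr_ge0// ltW.
pose A := @far_cst R n (n%:R + s) * (r `^ (- s) * 2^-1 `^ (- s)) * V.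
have A0 : 0 <= A by rewrite /A mulr_ge0// mulr_ge0// mulr_ge0 ?powR_ge0.
have z1 : 0 < (2^-1 : R) `^ (1 - s) < 1.
  by rewrite powR_gt0//= powR_lt1 ?subr_gt0// h0 invf_lt1// ltr1n.
have := @integral_geometric_cover _ _ _ mu (Om `&` cube x0 r) E
  (fun k => @far_cst R n (n%:R + s) * (r * 2^-1 ^+ k * 2^-1) `^ (- s)) A
  (2^-1 `^ (1 - s)) exit_rate mE.
move=> /(_ (measurableI _ _ mOm (measurable_cube _ _))) H.
apply: (le_lt_trans (H _ _ _ _ A0 z1 _)).
- move=> x [Ox cx] _; have /andP[t0 tb] := tB _ cx Ox.
  have [k] := exists_dyadic_below t0 tb; rewrite mulr1 => hk.
  by exists k; split.
- by move=> x _; exact: exit_rate_ge0.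
- by move=> k; rewrite mulr_ge0 ?powR_ge0.
- move=> k x [Ox cx] [_ /= /andP[h1 _]]; apply: exit_rate_le => // y Oy.
  rewrite -(ler_pM2l T0) (le_trans _ (tT _ _ cx Ox Oy))//.
  by rewrite (le_trans _ h1)// /B !mulrA.
- move=> k; apply: (@le_trans _ _ ((@far_cst R n (n%:R + s) *
      (r * 2^-1 ^+ k * 2^-1) `^ (- s))%:E * (V * 2^-1 ^+ k)%:E)%E).
    apply: lee_wpmul2l; first by rewrite lee_fin mulr_ge0 ?powR_ge0.
    exact: lebesgue_strip.
  have hk0 : 0 < (2^-1 : R) ^+ k by rewrite exprn_gt0.
  rewrite -EFinM lee_fin -powR_exprn ?(ltW h0)// powRD ?(gt_eqF hk0) ?implybT//.
  rewrite powRr1 ?(ltW hk0)// !powRM ?mulr_ge0 ?(ltW h0) ?(ltW hk0) ?(ltW r0)// /A.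
  by rewrite le_eqVlt; apply/orP; left; apply/eqP; ring.
- exact: ltry.
Qed.

End perimeter.

(** * Height over the boundary in a Lipschitz chart *)

Section charts.
Context {R : realType} {n : nat}.
Local Notation mu := (lebesgue_rV R n).

Lemma normrV_le m (x : 'rV[R]_m) (a : R) : 0 <= a ->
  (forall i, `|x ord0 i| <= a) -> `|x| <= a.
Proof.
move=> a0 h; rewrite /Num.norm/= mx_normrE; apply/bigmax_leP; split=> //.
by move=> [j i] _; rewrite (ord1 j); exact: h.
Qed.

Lemma normrV_mulmx_le (Q : 'M[R]_n) (x : 'rV[R]_n) :
  `|x *m Q| <= (\sum_k \sum_j `|Q j k|) * `|x|.
Proof.
apply: normrV_le => [|k].
  by rewrite mulr_ge0// sumr_ge0// => k _; rewrite sumr_ge0.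
rewrite mxE (le_trans (ler_norm_sum _ _ _))//.
apply: (@le_trans _ _ (\sum_j `|Q j k| * `|x|)).
  by apply: ler_sum => j _; rewrite normrM mulrC ler_wpM2l// normrV_coord.
rewrite -mulr_suml ler_wpM2r// [leRHS](bigD1 k)//= lerDl.
by rewrite sumr_ge0// => k' _; rewrite sumr_ge0.
Qed.

(** Measured along the vertical axis of the chart rather than perpendicularly to the graph, so that
    a vertical translation by l changes it by exactly l, as [lebesgue_strip] demands; its Lipschitz
    bound compares it with the distance to the complement. *)
Definition height (Q : 'M[R]_n) (i : 'I_n) (psi : 'rV[R]_n.-1 -> R)
  (x : 'rV[R]_n) : R := (x *m Q) ord0 i - psi (col' i (x *m Q)).

(** [delta_mx 0 i *m Q^T] is the vertical direction of the chart in the original coordinates: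
    multiplied by Q it becomes the i-th unit vector, which [col' i] does not see. *)
Lemma height_shift (Q : 'M[R]_n) (i : 'I_n) psi x l : Q *m Q^T = 1%:M ->
  height Q i psi (x + l *: (delta_mx 0 i *m Q^T)) = height Q i psi x + l.
Proof.
move=> QQ; have QQ' : Q^T *m Q = 1%:M by exact: mulmx1C.
rewrite /height mulmxDl -scalemxAl -mulmxA QQ' mulmx1.
have -> : col' i (x *m Q + l *: delta_mx 0 i) = col' i (x *m Q).
  apply/rowP => j; rewrite !mxE (_ : lift i j == i = false) ?andbF ?mulr0 ?addr0//.
  by rewrite eq_sym; exact/negbTE/neq_lift.
by rewrite !mxE !eqxx mulr1; lra.
Qed.

Lemma height_lipschitz (Q : 'M[R]_n) (i : 'I_n) psi : lipschitz psi ->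
  exists2 T : R, 0 < T &
    forall x y, `|height Q i psi x - height Q i psi y| <= T * `|x - y|.
Proof.
move=> /pinfty_ex_gt0[L L0 psiL].
have {}psiL u v : `|psi u - psi v| <= L * `|u - v| by exact: (psiL (u, v)).
pose q := \sum_k \sum_j `|Q j k|.
have q0 : 0 <= q by rewrite sumr_ge0// => k _; rewrite sumr_ge0.
exists ((1 + L) * (q + 1)).
  by apply: mulr_gt0; lra.
move=> x y; pose z := (x - y) *m Q.
have -> : height Q i psi x - height Q i psi y =
    z ord0 i - (psi (col' i (x *m Q)) - psi (col' i (y *m Q))).
  by rewrite /height /z mulmxBl !mxE; lra.
have zq : `|z| <= (q + 1) * `|x - y|.
  rewrite (le_trans (normrV_mulmx_le _ _))// ler_wpM2r// -/q; lra.
rewrite (le_trans (ler_normB _ _))// mulrDl mul1r mulrDl lerD//.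
  by rewrite (le_trans (normrV_coord _ _)).
rewrite (le_trans (psiL _ _))// -mulrA ler_pM2l// (le_trans _ zq)//.
apply: normrV_le => // j.
by rewrite (_ : _ ord0 j = z ord0 (lift i j)) ?normrV_coord// /z mulmxBl !mxE.
Qed.

End charts.

(** * Finiteness of the fractional perimeter *)

Section lipschitz_perimeter.
Context {R : realType} {n : nat}.
Variables (s : R) (Om : set 'rV[R]_n).
Hypothesis (n0 : (0 < n)%N) (s0 : 0 < s) (s1 : s < 1).
Hypothesis (oOm : open Om) (bOm : bounded_set Om) (lOm : lipschitz_boundary Om).
Local Notation mu := (lebesgue_rV R n).

Lemma open_cube (x : 'rV[R]_n) r : 0 < r -> open (cube x r).
Proof.
move=> r0; rewrite openE => y /cubeP; rewrite r0 => /(_ isT) xy.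
rewrite /interior -(@nbhs_nbhs_norm _ 'rV[R]_n).
exists (r - `|x - y|); first by rewrite /= subr_gt0.
move=> z /= yz; apply/cubeP => //.
rewrite (_ : x - z = (x - y) + (y - z)); last by rewrite addrA subrK.
by rewrite (le_lt_trans (ler_normD _ _))// -ltrBrDl.
Qed.

(** At an interior point the distance to the complement is bounded below nearby, so the exit rate is
    bounded; at a boundary point the height of the chart satisfies the requirements of
    [exit_rate_strip_lty]. *)
Lemma exit_rate_local_lty x0 : closure Om x0 ->
  exists2 r, 0 < r & (\int[mu]_(x in Om `&` cube x0 r) exit_rate s Om x < +oo)%E.
Proof.
move=> cx0; have mOm := open_measurable_rV oOm.
have [Ox0|nOx0] := pselect (Om x0).
  have /nbhs_normP[/= r r0 rO] : nbhs x0 Om by exact: open_nbhs_nbhs.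
  exists (r / 2); first by rewrite divr_gt0.
  have r20 : 0 < r / 2 by rewrite divr_gt0.
  have mD : measurable (Om `&` cube x0 (r / 2)).
    by apply: measurableI => //; exact: measurable_cube.
  pose c := (@far_cst R n (n%:R + s) * (r / 2) `^ (- s))%R.
  have c0 : 0 <= c by rewrite mulr_ge0 ?powR_ge0// ltW// far_cst_gt0// ltrDl.
  apply: (@le_lt_trans _ _ (\int[mu]_(x in Om `&` cube x0 (r / 2)) c%:E)%E).
    apply: ge0_le_integral_ae => //; first by move=> x _; exact: exit_rate_ge0.
    apply: aeW => x [_ /cubeP]; rewrite r20 => /(_ isT) x0x.
    apply: exit_rate_le => // y nOy; rewrite leNgt; apply/negP => xy.
    apply: nOy; apply: rO => /=.
    rewrite (_ : x0 - y = (x0 - x) + (x - y)); last by rewrite addrA subrK.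
    by rewrite (le_lt_trans (ler_normD _ _))// (splitr r) ltrD.
  rewrite integral_cst// lte_mul_pinfty//.
  apply: (@le_lt_trans _ _ (mu (cube x0 (r / 2)))).
    by apply: le_measure; rewrite ?inE//; exact: measurable_cube.
  by rewrite lebesgue_cube ?(ltW r20)// ltry.
have [Q [i [psi [r [QQ lpsi r0 HO]]]]] := lOm (conj cx0 (fun h => nOx0 (interior_subset h))).
have [T T0 hT] := height_lipschitz Q i lpsi.
have n0' : 0 < n%:R :> R by rewrite ltr0n.
(* The division by n passes from the sup norm to the Euclidean one. The division by 2 leaves a
   margin: a point that is not within 2 d of x0 is at distance at least d from the cube of half-side
   d. *)
pose d := r / n%:R / 2.
have d0 : 0 < d by rewrite !divr_gt0.
have inball x : `|x - x0| < 2 * d -> enorm (x - x0) < r.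
  move=> h; rewrite (le_lt_trans (enorm_le_normrV _))//.
  by rewrite mulrC -ltr_pdivlMr// (lt_le_trans h)// /d mulrC divfK.
have hO x : enorm (x - x0) < r -> Om x <-> 0 < height Q i psi x.
  by move=> xr; rewrite /height subr_gt0; exact: HO.
have h0 : height Q i psi x0 <= 0.
  rewrite leNgt; apply/negP => h; apply: nOx0; apply/hO => //.
  by rewrite subrr enorm0.
exists d => //.
apply: (@exit_rate_strip_lty _ _ _ _ s0 s1 oOm (height Q i psi)
  (delta_mx 0 i *m Q^T) x0 d T) => //.
- exact: lipschitz_continuous hT.
- by move=> x l; exact: height_shift.
- move=> x /cubeP; rewrite d0 => /(_ isT); rewrite distrC => xd Ox.
  have xb : enorm (x - x0) < r by apply: inball; lra.
  apply/andP; split; first exact/hO.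
  have : height Q i psi x - height Q i psi x0 < T * d.
    rewrite (le_lt_trans (ler_norm _))// (le_lt_trans (hT _ _))//.
    by rewrite ltr_pM2l.
  by lra.
- move=> x y /cubeP; rewrite d0 => /(_ isT); rewrite distrC => xd Ox nOy.
  have [yb|yb] := ltP `|y - x0| (2 * d).
    have hy : height Q i psi y <= 0.
      by rewrite leNgt; apply/negP => h; apply: nOy; apply/hO => //; exact: inball.
    have := le_trans (ler_norm _) (hT x y); lra.
  (* Here y may leave the chart and its height says nothing; but x has height at most T d, because
     x0 has nonpositive height. *)
  have xy : d <= `|x - y|.
    have : `|y - x0| <= `|x - y| + `|x - x0|.
      rewrite (distrC x y) (_ : y - x0 = (y - x) + (x - x0)) ?ler_normD//.
      by rewrite addrA subrK.
    by lra.
  have : height Q i psi x - height Q i psi x0 <= T * d.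
    rewrite (le_trans (ler_norm _))// (le_trans (hT _ _))//.
    by rewrite ler_pM2l// ltW.
  have : T * d <= T * `|x - y| by rewrite ler_pM2l.
  by lra.
Qed.

(** The closure of Om is compact, so finitely many of the cubes given by [exit_rate_local_lty] cover
    it. *)
Lemma exit_rate_lty : (\int[mu]_(x in Om) exit_rate s Om x < +oo)%E.
Proof.
have mOm := open_measurable_rV oOm.
have cK : compact (closure Om).
  apply: bounded_closed_compact; last exact: closed_closure.
  case: bOm => M [Mr bM]; exists M; split=> // k Mk x cx.
  have cl : closed (Num.norm @^-1` [set r : R | r <= k] : set 'rV[R]_n).
    apply: closed_comp; last exact: closed_le.
    by move=> y _; exact: norm_continuous.
  have sub : Om `<=` (Num.norm @^-1` [set r : R | r <= k] : set 'rV[R]_n).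
    by move=> y Oy; exact: bM.
  by have /closure_id clE := cl; have := closure_subset sub cx; rewrite -clE.
pose rad (x : 'rV[R]_n) : R := if pselect (closure Om x) is left h
  then sval (cid2 (exit_rate_local_lty h)) else 1.
have radP x : closure Om x -> 0 < rad x /\
    (\int[mu]_(y in Om `&` cube x (rad x)) exit_rate s Om y < +oo)%E.
  move=> cx; rewrite /rad; case: pselect => // h.
  by case: cid2.
move: cK; rewrite compact_cover => /(_ _ (closure Om) (fun x => cube x (rad x))).
case.
- by move=> x cx; apply: open_cube; have [] := radP _ cx.
- by move=> x cx; exists x => // i; rewrite subrr normr0; have [] := radP _ cx.
move=> D' D'sub cov.
have H (l : seq 'rV[R]_n) : {subset l <= closure Om} ->
    measurable (\big[setU/set0]_(i <- l) (Om `&` cube i (rad i))) /\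
    (\int[mu]_(x in \big[setU/set0]_(i <- l) (Om `&` cube i (rad i))) exit_rate s Om x < +oo)%E.
  elim: l => [|a l IH] sub; first by rewrite big_nil integral_set0; split => //; exact: ltry.
  have [mU iU] := IH (fun x xl => sub x (mem_behead (s := a :: l) xl)).
  have mC : measurable (Om `&` cube a (rad a)).
    by apply: measurableI => //; exact: measurable_cube.
  rewrite big_cons; split; first exact: measurableU.
  apply: ge0_integral_setU_lty => //; first exact: measurable_exit_rate.
    by move=> x; exact: exit_rate_ge0.
  by have [] := radP a; first exact/set_mem/sub/mem_head.
have [mU iU] := H (finmap.enum_fset D') (fun x xD => D'sub x xD).
apply: le_lt_trans iU; apply: ge0_subset_integral => //.
- by apply: measurable_funTS; exact: measurable_exit_rate.
- by move=> x _; exact: exit_rate_ge0.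
move=> x Ox; have [y /= yD yx] := cov _ (subset_closure Ox).
by rewrite -bigcup_seq; exists y.
Qed.

End lipschitz_perimeter.

(** * Neighbourhoods of the domain, and kernel bounds on their two sides *)

Section neighbourhoods.
Context {R : realType} {n : nat}.
Local Notation mu := (lebesgue_rV R n).

Lemma enorm_continuous : continuous (@enorm R n).
Proof.
move=> x; apply: (@continuous_comp _ _ _ (fun x : 'rV[R]_n => \sum_(i < n) x ord0 i ^+ 2) Num.sqrt).
  apply: continuous_big => [|i _ y]; first exact: add_continuous.
  apply: (@continuous_comp _ _ _ (fun x : 'rV[R]_n => x ord0 i) (fun t : R => t ^+ 2)).
    exact: coord_continuous.
  exact: exprn_continuous.
exact: sqrt_continuous.
Qed.

Lemma enlargeP (Om : set 'rV[R]_n) r x :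
  enlarge Om r x <-> exists2 y, Om y & enorm (x - y) < r.
Proof.
rewrite /enlarge /dist /=; split=> [/ereal_inf_lt[_ [y Oy <-]]|[y Oy yr]].
  by rewrite lte_fin => yr; exists y.
by rewrite (@le_lt_trans _ _ (enorm (x - y))%:E)//; apply: ereal_inf_lbound; exists y.
Qed.

Lemma open_enlarge (Om : set 'rV[R]_n) r : open (enlarge Om r).
Proof.
rewrite openE => x /enlargeP[y Oy xy]; rewrite /interior.
have cb : continuous (fun x' : 'rV[R]_n => enorm (x' - y)).
  move=> z; apply: (@continuous_comp _ _ _ (fun x' : 'rV[R]_n => x' - y) (@enorm R n)).
    by apply: continuousB; [move=> A|exact: cst_continuous].
  exact: enorm_continuous.
have : \forall z \near x, enorm (z - y) < r.
  have /cvgrPdist_lt := cb x => /(_ (r - enorm (x - y))); rewrite subr_gt0 => /(_ xy).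
  apply: filterS => z /= h.
  have := le_lt_trans (ler_norm _) h; have := ler_norm (enorm (x - y) - enorm (z - y)).
  by move: h; rewrite distrC => /(le_lt_trans (ler_norm _)); lra.
by apply: filterS => z zr; apply/enlargeP; exists y.
Qed.

End neighbourhoods.

Section domain_geometry.
Context {R : realType} {n : nat}.
Variables (s : R) (Om : set 'rV[R]_n).
Hypothesis (n0 : (0 < n)%N) (s0 : 0 < s) (s1 : s < 1).
Hypothesis (oOm : open Om) (bOm : bounded_set Om).
Local Notation mu := (lebesgue_rV R n).
Local Notation d := (diam Om).
Let n_gt0 : 0 < n%:R :> R. Proof. by rewrite ltr0n. Qed.
Let n_ge1 : 1 <= n%:R :> R. Proof. by rewrite ler1n. Qed.

Lemma diam_gt0 : Om !=set0 -> 0 < d.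
Proof.
move=> [x Ox].
have /nbhs_normP[/= r r0 rO] : nbhs x Om by exact: open_nbhs_nbhs.
pose y : 'rV[R]_n := x + const_mx (r / 2).
have r20 : 0 < r / 2 by rewrite divr_gt0.
have Oy : Om y.
  apply: rO => /=; rewrite opprD addrA subrr add0r normrN.
  apply/normrV_lt => // i; rewrite mxE gtr0_norm//.
  by rewrite ltr_pdivrMr// ltr_pMr// ltr1n.
apply: lt_le_trans (diam_ge bOm Oy Ox).
apply: enorm_gt0 => /rowP/(_ (Ordinal n0)); rewrite !mxE; lra.
Qed.

Definition far_set Theta := ~` enlarge Om (Theta * d).

Definition near_set Theta := enlarge Om (Theta * d) `\` Om.

Lemma measurable_near_set Theta : measurable (near_set Theta).
Proof.
apply: measurableD; apply: open_measurable_rV => //; exact: open_enlarge.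
Qed.

Lemma measurable_far_set Theta : measurable (far_set Theta).
Proof. by apply: measurableC; apply: open_measurable_rV; exact: open_enlarge. Qed.

Lemma setC_near_far Theta : 0 < Theta * d ->
  ~` Om = near_set Theta `|` far_set Theta.
Proof.
move=> T0; apply/seteqP; split=> x /=.
  move=> nO; have [e|ne] := pselect (enlarge Om (Theta * d) x); first by left.
  by right.
case=> [[]//|+ Ox]; apply; apply/enlargeP; exists x => //.
by rewrite subrr enorm0.
Qed.

(* The cube of half-side d around x + 2 d (1, ..., 1) is at distance more than d
   and less than 3 n d from x, so it lies in the near set. *)
Definition near_kappa : R := (3 * n%:R) `^ (- (n%:R + s)) * 2 ^+ n.

Lemma near_kappa_gt0 : 0 < near_kappa.
Proof. by rewrite mulr_gt0 ?powR_gt0 ?mulr_gt0 ?exprn_gt0. Qed.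

Lemma kernel_near_set_ge Theta x : Om x -> 3 * n%:R <= Theta ->
  ((near_kappa * d `^ (- s))%:E <=
    \int[mu]_(y in near_set Theta) (kernel (n%:R + s) x y)%:E)%E.
Proof.
move=> Ox ThetaP; have d0 : 0 < d by apply: diam_gt0; exists x.
pose z : 'rV[R]_n := x + const_mx (2 * d).
have rng y i : cube z d y -> d < y ord0 i - x ord0 i < 3 * d.
  by move=> /(_ i); rewrite !mxE ltr_norml => /andP[h1 h2]; apply/andP; split; lra.
have sub y : cube z d y -> d < enorm (x - y) < 3 * n%:R * d.
  move=> zy; apply/andP; split.
    have /andP[h _] := rng y (Ordinal n0) zy.
    rewrite (lt_le_trans _ (enorm_coord _ (Ordinal n0)))// !mxE distrC.
    by rewrite (lt_le_trans h)// ler_norm.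
  rewrite (le_lt_trans (enorm_le_normrV _))// (mulrC 3) -mulrA ltr_pM2l//.
  apply/normrV_lt => [|i]; first by rewrite mulr_gt0.
  have /andP[h1 h2] := rng y i zy.
  by rewrite !mxE distrC gtr0_norm//; lra.
have zN : cube z d `<=` near_set Theta.
  move=> y /sub/andP[h1 h2]; split.
    apply/enlargeP; exists x => //; rewrite enormC (lt_le_trans h2)//.
    by rewrite ler_wpM2r// ltW.
  by move=> Oy; have := diam_ge bOm Ox Oy; rewrite leNgt h1.
have c0 : 0 <= (3 * n%:R * d) `^ (- (n%:R + s)) by exact: powR_ge0.
apply: (@le_trans _ _ (\int[mu]_(y in cube z d) ((3 * n%:R * d) `^ (- (n%:R + s)))%:E)%E).
  rewrite (_ : (\int[mu]_(y in cube z d) _)%E =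
      ((3 * n%:R * d) `^ (- (n%:R + s)) * (2 * d) ^+ n)%:E); last first.
    rewrite integral_cst; last exact: measurable_cube.
    by rewrite EFinM; congr (_ * _)%E; exact: lebesgue_cube (ltW d0).
  rewrite lee_fin /near_kappa.
  rewrite (@powRM _ (3 * n%:R) d) ?mulr_ge0 ?(ltW d0)// exprMn.
  rewrite (_ : d `^ (- s) = d `^ (- (n%:R + s)) * d ^+ n).
    by rewrite le_eqVlt; apply/orP; left; apply/eqP; ring.
  rewrite -powR_mulrn ?(ltW d0)// -powRD ?(gt_eqF d0) ?implybT//.
  by congr (_ `^ _); lra.
apply: (@le_trans _ _ (\int[mu]_(y in cube z d) (kernel (n%:R + s) x y)%:E)%E).
  apply: ge0_le_integral_ae => [y _|y _|].
  - by rewrite lee_fin.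
  - by rewrite lee_fin kernel_ge0.
  apply: aeW => y /sub/andP[h1 h2]; rewrite lee_fin powRN /kernel.
  rewrite lef_pV2 ?posrE ?powR_gt0//; last 2 first.
  - by rewrite !mulr_gt0.
  - exact: lt_trans h1.
  apply: ge0_ler_powR; rewrite ?nnegrE ?enorm_ge0 ?(ltW h2)//.
    by rewrite addr_ge0// ltW.
  by rewrite !mulr_ge0// ltW.
apply: ge0_subset_integral => //; first exact: measurable_cube.
- exact: measurable_near_set.
- by apply/measurable_EFinP; apply: measurable_funTS; exact: measurable_kernelr.
- by move=> y _; rewrite lee_fin kernel_ge0.
Qed.

(** The far set keeps a sup-norm distance of Theta d / n from x, hence the factor Theta^(-s), the
    only one that the choice of Theta makes small. *)
Lemma kernel_far_set_le Theta x : Om x -> 0 < Theta ->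
  (\int[mu]_(y in far_set Theta) (kernel (n%:R + s) x y)%:E <=
   (@far_cst R n (n%:R + s) * n%:R `^ s * Theta `^ (- s) * d `^ (- s))%:E)%E.
Proof.
move=> Ox T0; have d0 : 0 < d by apply: diam_gt0; exists x.
have r0 : 0 < Theta * d / n%:R by rewrite divr_gt0 ?mulr_gt0.
have := @kernel_far R n (n%:R + s) x _ (far_set Theta) (measurable_far_set _) r0.
rewrite ltrDl => /(_ s0) H; apply: le_trans (H _) _.
  move=> y ny; rewrite ler_pdivrMr// [leRHS]mulrC (le_trans _ (enorm_le_normrV _))//.
  rewrite leNgt; apply/negP => h; apply: ny; apply/enlargeP; exists x => //.
  by rewrite enormC.
rewrite lee_fin opprD addrA subrr add0r.
rewrite powRM ?mulr_ge0 ?invr_ge0 ?(ltW d0) ?(ltW T0)//.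
rewrite powRM ?(ltW d0) ?(ltW T0)//.
rewrite (_ : n%:R^-1 `^ (- s) = n%:R `^ s).
  by rewrite le_eqVlt; apply/orP; left; apply/eqP; ring.
by rewrite -powR_inv1// -powRrM mulN1r opprK.
Qed.

Let q := n%:R - 1 + s.

Let q_bounds : 0 < q < n%:R.
Proof.
have s0' := s0; have s1' := s1.
by rewrite /q; move: n%:R n_ge1 => N N1; apply/andP; split; lra.
Qed.

Let nq : n%:R - q = 1 - s. Proof. by rewrite /q; lra. Qed.

Let kernel_q_near (D : set 'rV[R]_n) x r : 0 < r -> measurable D -> D `<=` cube x r ->
  (\int[mu]_(y in D) (kernel q x y)%:E <= (@near_cst R n q * r `^ (1 - s))%:E)%E.
Proof.
move=> r0 mD Dx; rewrite -nq; apply: le_trans (kernel_near x r0 q_bounds).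
apply: ge0_subset_integral => //; first exact: measurable_cube.
- by apply/measurable_EFinP; apply: measurable_funTS; exact: measurable_kernelr.
- by move=> y _; rewrite lee_fin kernel_ge0.
Qed.

(** The order n - 1 + s is below n, so the kernel is integrable across the diagonal, and the near
    set fits in the cube of half-side (1 + Theta) d around x. *)
Lemma kernel_near_set_le Theta x : Om x -> 0 < Theta ->
  (\int[mu]_(y in near_set Theta) (kernel (n%:R - 1 + s) x y)%:E <=
   (@near_cst R n (n%:R - 1 + s) * (1 + Theta) `^ (1 - s) * d `^ (1 - s))%:E)%E.
Proof.
move=> Ox T0; have d0 : 0 < d by apply: diam_gt0; exists x.
rewrite -mulrA -powRM ?(ltW d0) ?addr_ge0 ?(ltW T0)//.
apply: kernel_q_near; first by rewrite mulr_gt0 ?addr_gt0.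
  exact: measurable_near_set.
move=> y [/enlargeP[z Oz yz] _]; apply/cubeP; first by rewrite mulr_gt0 ?addr_gt0.
rewrite (_ : x - y = (x - z) + (z - y)); last by rewrite addrA subrK.
rewrite (le_lt_trans (ler_normD _ _))// mulrDl mul1r ler_ltD//.
  exact: le_trans (normrV_le_enorm _) (diam_ge bOm Ox Oz).
by rewrite (le_lt_trans (normrV_le_enorm _))// enormC.
Qed.

Lemma kernel_domain_le x : Om x ->
  (\int[mu]_(y in Om) (kernel (n%:R - 1 + s) x y)%:E <=
   (@near_cst R n (n%:R - 1 + s) * 2 `^ (1 - s) * d `^ (1 - s))%:E)%E.
Proof.
move=> Ox; have d0 : 0 < d by apply: diam_gt0; exists x.
rewrite -mulrA -powRM ?(ltW d0)//.
apply: kernel_q_near; first by rewrite mulr_gt0.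
  exact: open_measurable_rV.
move=> y Oy; apply/cubeP; first by rewrite mulr_gt0.
rewrite (le_lt_trans (normrV_le_enorm _))// (le_lt_trans (diam_ge bOm Ox Oy))//.
by rewrite mulr_natl mulr2n ltrDl.
Qed.

End domain_geometry.

(** * Pointwise inequalities for the densities of N and A *)

Section interaction.
Context {R : realType}.
Variables (g : R -> R) (M : R).
Hypothesis g_cont : continuous g.
Hypothesis g_gt0 : forall t : R, 0 < g t.
Hypothesis g_le1 : forall t : R, g t <= 1.
Hypothesis g_int : (\int[@lebesgue_measure R]_t (g t * `|t|)%:E < +oo)%E.
Hypothesis M0 : 0 <= M.

Local Notation HH := (oriented_int (barG_odd g) 0).
Let cHodd := continuous_barG_odd g_cont g_gt0 g_le1 g_int.

Definition crossN (a b r : R) : R :=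
  crossG g ((- M - b) / r) ((a - b) / r) ((M - b) / r).

Let HH_le x : HH x <= mass g * `|x|.
Proof.
rewrite -[x in `|x|]subr0; apply: le_trans (ler_norm _) _.
by apply: ler_oriented_int => // t; exact: barG_odd_norm.
Qed.

Let HH_lip x y : HH y - HH x <= mass g * `|y - x|.
Proof.
rewrite oriented_intBr//; apply: le_trans (ler_norm _) _.
by apply: ler_oriented_int => // t; exact: barG_odd_norm.
Qed.

Let HH_coercive x : slope g * (`|x| - 1) <= HH x.
Proof.
have sl := barG_odd_slope g_cont g_gt0 g_le1 g_int.
by have [] := oriented_int_coercive x cHodd sl.
Qed.

Let crossN_shift a b r : crossN a b r =
  crossN 0 b r + (HH ((a - b) / r) - HH ((0 - b) / r)).
Proof. exact: crossG_shift. Qed.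

(** The gain K((a - b)/r) is at least slope (|a - b|/r - 1) and the loss K(-b/r) at most mass |b|/r.
    Replacing |a - b| by |a| costs a further slope |b|/r, whence the sum of slope and mass in front
    of |b|. *)
Lemma crossN_near a b r : 0 < r ->
  crossN 0 b r + slope g * (`|a| / r) <=
  crossN a b r + (slope g + mass g) * (`|b| / r) + slope g.
Proof.
move=> r0; rewrite (crossN_shift a).
have := HH_coercive ((a - b) / r); have := HH_le ((0 - b) / r).
move: (HH _) (HH _) (crossN 0 b r) => p q c.
rewrite sub0r mulNr normrN !normrM (gtr0_norm (_ : 0 < r^-1)) ?invr_gt0//.
have S0 : 0 < slope g by exact: slope_gt0.
have : slope g * (`|a| / r) <= slope g * (`|a - b| / r) + slope g * (`|b| / r).
  rewrite -mulrDr -mulrDl ler_pM2l// ler_pM2r ?invr_gt0//.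
  by rewrite -[in leLHS](subrK b a) ler_normD.
rewrite mulrBr [in X in _ -> _ -> _ -> X]mulrDl mulr1.
move: (slope g * (`|a| / r)) (mass g * (`|b| / r)) => A Bm.
move: (slope g * (`|a - b| / r)) (slope g * (`|b| / r)) (slope g) => D B S.
by lra.
Qed.

Lemma crossN_far a b r : 0 < r ->
  crossN 0 b r <= crossN a b r + mass g * (`|a| / r).
Proof.
move=> r0; rewrite (crossN_shift a).
have := HH_lip ((a - b) / r) ((0 - b) / r).
rewrite -mulrBl (_ : 0 - b - (a - b) = - a); last by lra.
rewrite normrM normrN (gtr0_norm (_ : 0 < r^-1)) ?invr_gt0//.
move: (HH _) (HH _) (crossN 0 b r) => p q c.
move: (mass g * _) => A.
by lra.
Qed.

(** For the value 0 the middle endpoint lies between the outer ones because M >= 0, so both oriented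
    integrals are nonnegative. For a general value it need not lie there, and the density may be
    negative. *)
Lemma crossN_bounds b r : 0 < r ->
  0 <= crossN 0 b r <= mass g * ((2 * M) / r).
Proof.
move=> r0; have ri : 0 < r^-1 by rewrite invr_gt0.
have -> : 2 * M / r = (M - b) / r - (- M - b) / r by rewrite -mulrBl; congr (_ / _); lra.
by apply: crossG_bounds => //; rewrite ler_pM2r//; have := M0; lra.
Qed.

Lemma primG2_coercive x : 0 <= primG2 g x /\ slope g * (`|x| - 1) <= primG2 g x.
Proof.
apply: oriented_int_coercive; first exact: continuous_primG.
exact: primG_slope.
Qed.

Lemma continuous_primG2 : continuous (primG2 g).
Proof.
apply: (@continuous_oriented_int _ _ (mass g)); first exact: continuous_primG.
by move=> t; exact: primG_norm.
Qed.

Lemma measurable_crossG d (T : measurableType d) (a b c : T -> R) :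
  measurable_fun setT a -> measurable_fun setT b -> measurable_fun setT c ->
  measurable_fun setT (fun z => crossG g (a z) (b z) (c z)).
Proof.
move=> ma mb mc.
have n1 t : `|barG g t| <= mass g.
  by rewrite ger0_norm ?barG_ge0// barG_le_mass.
have c1 := continuous_barG g_cont g_gt0 g_le1 g_int.
have c2 := continuous_barGN g_cont g_gt0 g_le1 g_int.
have m1 : measurable_fun setT (oriented_int (barG g) 0).
  by apply: continuous_measurable_fun; exact: (continuous_oriented_int c1 n1).
have m2 : measurable_fun setT (oriented_int (fun t => barG g (- t)) 0).
  apply: continuous_measurable_fun.
  exact: (continuous_oriented_int c2 (fun t => n1 (- t))).
rewrite (_ : (fun z => _) = fun z =>
    (oriented_int (barG g) 0 (b z) - oriented_int (barG g) 0 (a z)) +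
    (oriented_int (fun t => barG g (- t)) 0 (c z) -
     oriented_int (fun t => barG g (- t)) 0 (b z))).
  apply: measurable_funD.
    exact: measurable_funB (measurableT_comp m1 mb) (measurableT_comp m1 ma).
  exact: measurable_funB (measurableT_comp m2 mc) (measurableT_comp m2 mb).
apply/funext => z; rewrite /crossG.
exact: (f_equal2 +%R (esym (oriented_intBr (a z) (b z) c1))
  (esym (oriented_intBr (b z) (c z) c2))).
Qed.

End interaction.

(** * The same inequalities weighted by the kernel *)

Section weighted_interaction.
Context {R : realType} {n : nat}.
Variables (g : R -> R) (M s : R).
Hypothesis g_cont : continuous g.
Hypothesis g_gt0 : forall t : R, 0 < g t.
Hypothesis g_le1 : forall t : R, g t <= 1.
Hypothesis g_int : (\int[@lebesgue_measure R]_t (g t * `|t|)%:E < +oo)%E.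
Hypothesis M0 : 0 <= M.
Hypothesis (s0 : 0 < s).
Implicit Types (x y : 'rV[R]_n) (u v : 'rV[R]_n -> R).
Local Notation p := (n%:R + s).
Local Notation q := (n%:R - 1 + s).

(** Convertible with the integrand of [funcN], as [integrandA] is with that of [funcA]: dividing by
    the power of the distance is multiplying by [kernel q]. *)
Definition integrandN u x y : R :=
  crossN g M (u x) (u y) (enorm (x - y)) * kernel q x y.

Definition integrandA u x y : R :=
  primG2 g ((u x - u y) / enorm (x - y)) * kernel q x y.

Lemma kernel_div x y : x <> y -> (enorm (x - y))^-1 * kernel q x y = kernel p x y.
Proof.
move=> /enorm_gt0 r0; rewrite /kernel -invfM; congr (_^-1).
rewrite -[X in X * _]powRr1 ?ltW// -powRD ?(gt_eqF r0) ?implybT//.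
by congr (_ `^ _); lra.
Qed.

Lemma integrandN_near u v x y : x <> y -> v x = 0 -> v y = u y ->
  integrandN v x y + slope g * `|u x| * kernel p x y <=
  integrandN u x y +
  ((slope g + mass g) * `|u y| * kernel p x y + slope g * kernel q x y).
Proof.
move=> xy vx vy; rewrite /integrandN vx vy -(kernel_div xy).
have r0 := enorm_gt0 xy; have k0 := kernel_ge0 q x y.
have := crossN_near M g_cont g_gt0 g_le1 g_int (u x) (u y) r0.
move=> /(ler_wpM2r k0).
move: (crossN _ _ 0 _ _) (crossN _ _ (u x) _ _) (kernel q x y) => c c' k.
move: `|u x| `|u y| (slope g) (mass g) (enorm (x - y))^-1 => a b S L r.
by rewrite !mulrDl; lra.
Qed.

Lemma integrandN_far u v x y : x <> y -> v x = 0 -> v y = u y ->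
  integrandN v x y <= integrandN u x y + mass g * `|u x| * kernel p x y.
Proof.
move=> xy vx vy; rewrite /integrandN vx vy -(kernel_div xy).
have r0 := enorm_gt0 xy; have k0 := kernel_ge0 q x y.
have := crossN_far M g_cont g_gt0 g_le1 g_int (u x) (u y) r0.
move=> /(ler_wpM2r k0).
move: (crossN _ _ 0 _ _) (crossN _ _ (u x) _ _) (kernel q x y) => c c' k.
move: `|u x| (mass g) (enorm (x - y))^-1 => a L r.
by rewrite !mulrDl; lra.
Qed.

Lemma integrandN_bounds v x y : x <> y -> v x = 0 ->
  0 <= integrandN v x y <= mass g * (2 * M) * kernel p x y.
Proof.
move=> xy vx; rewrite /integrandN vx -(kernel_div xy).
have r0 := enorm_gt0 xy; have k0 := kernel_ge0 q x y.
have /andP[h1 h2] := crossN_bounds g_cont g_gt0 g_le1 g_int M0 (v y) r0.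
apply/andP; split; first exact: mulr_ge0.
by rewrite (le_trans (ler_wpM2r k0 h2))// !mulrA.
Qed.

Lemma integrandA_ge0 u x y : 0 <= integrandA u x y.
Proof.
rewrite mulr_ge0 ?kernel_ge0//.
by have [] := primG2_coercive g_cont g_gt0 g_le1 ((u x - u y) / enorm (x - y)).
Qed.

Lemma integrandA_coercive u x y :
  slope g * (`|u x - u y| * kernel p x y) <=
  integrandA u x y + slope g * kernel q x y.
Proof.
have S0 : 0 < slope g by exact: slope_gt0.
have k0 := kernel_ge0 q x y.
have [->|/eqP xy] := eqVneq x y.
  by rewrite subrr normr0 mul0r mulr0 addr_ge0 ?integrandA_ge0// mulr_ge0 ?kernel_ge0// ltW.
have r0 := enorm_gt0 xy; rewrite -(kernel_div xy) /integrandA.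
have [_] := primG2_coercive g_cont g_gt0 g_le1 ((u x - u y) / enorm (x - y)).
rewrite normrM (gtr0_norm (_ : 0 < _^-1)) ?invr_gt0//.
move=> /(ler_wpM2r k0).
rewrite -(lerD2r (slope g * kernel q x y)); apply: le_trans.
move: (kernel q x y) `|u x - u y| (slope g) (enorm (x - y))^-1 => k a S r.
by rewrite mulrBr mulrBl; lra.
Qed.

Lemma measurable_div_enorm (f : 'rV[R]_n * 'rV[R]_n -> R) :
  measurable_fun setT f ->
  measurable_fun setT (fun z => f z / enorm (z.1 - z.2)).
Proof.
move=> mf; apply: measurable_funM => //.
under eq_fun do rewrite -powR_inv1 ?enorm_ge0//.
apply: (measurableT_comp (@measurable_powR R (-1))).
exact: measurable_enormB.
Qed.

Let measurable_u1 u : measurable_fun setT u ->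
  measurable_fun setT (fun z : 'rV[R]_n * 'rV[R]_n => u z.1).
Proof. by move=> mu; apply: measurableT_comp. Qed.

Let measurable_u2 u : measurable_fun setT u ->
  measurable_fun setT (fun z : 'rV[R]_n * 'rV[R]_n => u z.2).
Proof. by move=> mu; apply: measurableT_comp. Qed.

Lemma measurable_integrandN u : measurable_fun setT u ->
  measurable_fun setT (fun z => integrandN u z.1 z.2).
Proof.
move=> mu; have m1 := measurable_u1 mu; have m2 := measurable_u2 mu.
apply: measurable_funM; last exact: measurable_kernel.
by apply: measurable_crossG => //; apply: measurable_div_enorm;
  apply: measurable_funB.
Qed.

Lemma measurable_integrandA u : measurable_fun setT u ->
  measurable_fun setT (fun z => integrandA u z.1 z.2).
Proof.
move=> mu; have m1 := measurable_u1 mu; have m2 := measurable_u2 mu.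
apply: measurable_funM; last exact: measurable_kernel.
apply: (measurableT_comp (f := primG2 g)).
  by apply: continuous_measurable_fun; exact: continuous_primG2.
by apply: measurable_div_enorm; apply: measurable_funB.
Qed.

Lemma measurable_abs_kernel (f : 'rV[R]_n * 'rV[R]_n -> R) r : measurable_fun setT f ->
  measurable_fun setT (fun z => `|f z| * kernel r z.1 z.2).
Proof.
move=> mf; apply: measurable_funM; last exact: measurable_kernel.
by apply: measurableT_comp.
Qed.

End weighted_interaction.

(** The gain w + w of the near set pays for the loss w of the far set. As w is real it can be
    cancelled even when X, Y or Z is infinite. *)
Lemma lee_cancel_half (R : realType) (X Y Z : \bar R) (w : R) :
  (X + (w + w)%:E <= Y + (Z + w%:E) -> X + w%:E <= Y + Z)%E.
Proof. by rewrite EFinD !addeA leeD2rE. Qed.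

(** * Choice of Theta, and comparison of u with its cut at a fixed point x *)

Section comparison.
Context {R : realType} {n : nat}.
Variables (g : R -> R) (M s : R) (Om : set 'rV[R]_n) (u : 'rV[R]_n -> R).
Hypothesis g_cont : continuous g.
Hypothesis g_gt0 : forall t : R, 0 < g t.
Hypothesis g_le1 : forall t : R, g t <= 1.
Hypothesis g_int : (\int[@lebesgue_measure R]_t (g t * `|t|)%:E < +oo)%E.
Hypothesis M0 : 0 <= M.
Hypothesis (n0 : (0 < n)%N) (s0 : 0 < s) (s1 : s < 1).
Hypothesis (oOm : open Om) (bOm : bounded_set Om).
Hypothesis u_meas : measurable_fun setT u.
Local Notation mu := (lebesgue_rV R n).
Local Notation d := (diam Om).
Local Notation p := (n%:R + s).
Local Notation q := (n%:R - 1 + s).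

Definition cut (x : 'rV[R]_n) : R := u x * \1_(~` Om) x.

Lemma cut_in x : Om x -> cut x = 0.
Proof. by move=> Ox; rewrite /cut indicE memNset ?mulr0//= => /(_ Ox). Qed.

Lemma cut_out x : ~ Om x -> cut x = u x.
Proof. by move=> Ox; rewrite /cut indicE mem_set ?mulr1. Qed.

Let mOm : measurable Om. Proof. exact: open_measurable_rV. Qed.
Let mCOm : measurable (~` Om). Proof. exact: measurableC. Qed.

Lemma measurable_cut : measurable_fun setT cut.
Proof. by apply: measurable_funM => //; exact: measurable_indic. Qed.

(** The value of Theta^s at which mass times the far bound equals half of slope times [near_kappa].
    The summand 3 n added to its s-th root in [Theta] makes room for the cube behind
    [near_kappa]. *)
Definition far_ratio : R :=
  2 * mass g * @far_cst R n p * n%:R `^ s / (slope g * @near_kappa R n s).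

(* Beyond Theta * diam the far kernel is absorbed by half of the near one. *)
Definition Theta : R := 3 * n%:R + far_ratio `^ (s^-1).

Let S0 : 0 < slope g. Proof. exact: slope_gt0. Qed.
Let L0 : 0 <= mass g. Proof. exact: mass_ge0. Qed.
Let k0 : 0 < @near_kappa R n s. Proof. exact: near_kappa_gt0. Qed.
Let F0 : 0 < @far_cst R n p. Proof. by apply: far_cst_gt0; rewrite ltrDl. Qed.
Let Nn : 0 < n%:R :> R. Proof. by rewrite ltr0n. Qed.

Lemma far_ratio_ge0 : 0 <= far_ratio.
Proof.
rewrite /far_ratio; apply: divr_ge0; last exact/ltW/mulr_gt0.
by apply: mulr_ge0; [apply: mulr_ge0; [exact: mulr_ge0|exact: ltW]|exact: powR_ge0].
Qed.

Lemma Theta_ge : 3 * n%:R <= Theta.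
Proof. by rewrite /Theta lerDl powR_ge0. Qed.

Lemma Theta_gt0 : 0 < Theta.
Proof. by apply: lt_le_trans Theta_ge; rewrite mulr_gt0. Qed.

Lemma Theta_absorbs :
  mass g * (@far_cst R n p * n%:R `^ s * Theta `^ (- s)) <=
  slope g * @near_kappa R n s / 2.
Proof.
have T0 := Theta_gt0; have Ts : 0 < Theta `^ s by rewrite powR_gt0.
have : far_ratio <= Theta `^ s.
  rewrite -[leLHS]powRr1 ?far_ratio_ge0// -(mulVf (lt0r_neq0 s0)) powRrM.
  apply: ge0_ler_powR; rewrite ?nnegrE ?powR_ge0 ?(ltW T0) ?(ltW s0)//.
  by rewrite /Theta lerDr mulr_ge0// ltW.
have Sk : 0 < slope g * @near_kappa R n s by rewrite mulr_gt0.
rewrite /far_ratio ler_pdivrMr// powRN mulrA ler_pdivrMr//.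
move: (slope g * _) Sk (Theta `^ s) => a _ t.
have -> : 2 * mass g * @far_cst R n p * n%:R `^ s =
  2 * (mass g * (@far_cst R n p * n%:R `^ s)) by rewrite !mulrA.
by move: (mass g * _) => b; lra.
Qed.

Local Notation Nr := (near_set Om Theta).
Local Notation Fr := (far_set Om Theta).

(** This and the next three are the coefficients of the tail, of the L1 norm of u (half of the near
    gain, the other half having absorbed the far loss), and of the measure of the domain, as
    contributed by N and by A. *)
Definition coefT : R := slope g + mass g.
Definition coefU : R := slope g * @near_kappa R n s / 2.
Definition coefN : R :=
  slope g * (@near_cst R n q * (1 + Theta) `^ (1 - s)).
Definition coefA : R := slope g * (@near_cst R n q * 2 `^ (1 - s)).

Let near0 : 0 < @near_cst R n q.
Proof.
have n1 : 1 <= n%:R :> R by rewrite ler1n.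
have s0' := s0; have s1' := s1.
by apply: near_cst_gt0; move: n%:R n1 => N N1; apply/andP; split; lra.
Qed.

Lemma coefT_gt0 : 0 < coefT.
Proof. by rewrite /coefT ltr_wpDr. Qed.

Lemma coefU_gt0 : 0 < coefU.
Proof. by rewrite /coefU divr_gt0// mulr_gt0. Qed.

Lemma coefN_gt0 : 0 < coefN.
Proof.
rewrite /coefN mulr_gt0// mulr_gt0// powR_gt0//.
by rewrite addr_gt0// Theta_gt0.
Qed.

Lemma coefA_gt0 : 0 < coefA.
Proof. by rewrite /coefA mulr_gt0// mulr_gt0// powR_gt0. Qed.

Definition crossing (w : 'rV[R]_n -> R) (x : 'rV[R]_n) : \bar R :=
  (\int[mu]_(y in ~` Om) (@integrandN R n g M s w x y)%:E)%E.

Definition near_tail (x : 'rV[R]_n) : \bar R :=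
  (\int[mu]_(y in Nr) (`|u y| * kernel p x y)%:E)%E.

Let meN (w : 'rV[R]_n -> R) (x : 'rV[R]_n) : measurable_fun setT w ->
  measurable_fun setT (fun y : 'rV[R]_n => (integrandN g M s w x y)%:E).
Proof.
move=> mw; apply/measurable_EFinP.
have mi := measurable_integrandN M s g_cont g_gt0 g_le1 g_int mw.
exact: (measurableT_comp mi (measurable_pair1 x)).
Qed.

Let mek r (x : 'rV[R]_n) : measurable_fun setT (fun y : 'rV[R]_n => (kernel r x y)%:E).
Proof. by apply/measurable_EFinP; exact: measurable_kernelr. Qed.

Let meu r (x : 'rV[R]_n) : measurable_fun setT (fun y : 'rV[R]_n => (`|u y| * kernel r x y)%:E).
Proof.
apply/measurable_EFinP; apply: measurable_funM; last exact: measurable_kernelr.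
by apply: measurableT_comp.
Qed.

Let mNr : measurable Nr. Proof. exact: measurable_near_set. Qed.
Let mFr : measurable Fr. Proof. exact: measurable_far_set. Qed.

Let integral_kernelZ (c r : R) (D : set 'rV[R]_n) x : measurable D -> 0 <= c ->
  (\int[mu]_(y in D) (c * kernel r x y)%:E =
   c%:E * \int[mu]_(y in D) (kernel r x y)%:E)%E.
Proof.
move=> mD c0; under eq_integral do rewrite EFinM.
rewrite ge0_integralZl_EFin//; first by move=> y _; rewrite lee_fin kernel_ge0.
exact: measurable_funTS.
Qed.

(** In y the comparison reads v + phi0 <= u + phi1 on the near set and v <= u + phi2 on the far set.
    Once the near tail at x is finite, phi1 and phi2 are integrable there and dominate the negative
    part of the density of u, which excludes -oo. *)
Lemma crossing_le x : Om x -> (near_tail x < +oo)%E ->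
  (crossing cut x + (coefU * d `^ (- s) * `|u x|)%:E <=
   crossing u x + (coefT%:E * near_tail x + (coefN * d `^ (1 - s))%:E))%E /\
  crossing u x != -oo%E.
Proof.
move=> Ox tx; have d0 : 0 < d by apply: (@diam_gt0 _ _ Om) => //; exists x.
have T0 := Theta_gt0; have Td : 0 < Theta * d by rewrite mulr_gt0.
have DE := setC_near_far Td.
pose phi0 y := (slope g * `|u x| * kernel p x y)%:E.
pose phi1 y := (coefT * (`|u y| * kernel p x y) + slope g * kernel q x y)%:E.
pose phi2 y := (mass g * `|u x| * kernel p x y)%:E.
have p00 y : (0 <= phi0 y)%E.
  by rewrite lee_fin mulr_ge0 ?kernel_ge0// mulr_ge0// ltW.
have p10 y : (0 <= phi1 y)%E.
  have c0 := ltW coefT_gt0.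
  rewrite lee_fin addr_ge0// mulr_ge0 ?kernel_ge0//; last exact: ltW.
  by rewrite mulr_ge0 ?kernel_ge0.
have p20 y : (0 <= phi2 y)%E.
  by rewrite lee_fin mulr_ge0 ?kernel_ge0// mulr_ge0.
have mp0 : measurable_fun setT phi0.
  apply/measurable_EFinP; apply: measurable_funM => //.
  exact: measurable_kernelr.
have mp1 : measurable_fun setT phi1.
  apply/measurable_EFinP; apply: measurable_funD; apply: measurable_funM => //.
    by apply/measurable_EFinP; exact: meu.
  exact: measurable_kernelr.
have mp2 : measurable_fun setT phi2.
  apply/measurable_EFinP; apply: measurable_funM => //.
  exact: measurable_kernelr.
have mr (A : set 'rV[R]_n) (f : 'rV[R]_n -> \bar R) : measurable A -> measurable_fun setT f ->
    measurable_fun (~` Om) (f \_ A).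
  move=> mA mf; apply: measurable_funTS.
  by apply/(measurable_restrictT f mA); exact: measurable_funTS.
have r0 (A : set 'rV[R]_n) (f : 'rV[R]_n -> \bar R) : (forall y, 0 <= f y)%E ->
    forall y, (0 <= (f \_ A) y)%E.
  by move=> f0 y; rewrite patchE; case: ifP.
have ir (A : set 'rV[R]_n) (f : 'rV[R]_n -> \bar R) : A `<=` ~` Om ->
    (\int[mu]_(y in ~` Om) (f \_ A) y = \int[mu]_(y in A) f y)%E.
  by move=> AO; rewrite -integral_mkcondr setIidr.
have NrO : Nr `<=` ~` Om by rewrite DE; exact: subsetUl.
have FrO : Fr `<=` ~` Om by rewrite DE; exact: subsetUr.
(* [coefU] already contains the factor 1/2, so the full gain is twice it; I2 below consumes one of
   the two halves. *)
have I0 : ((2 * coefU * d `^ (- s) * `|u x|)%:E <= \int[mu]_(y in Nr) phi0 y)%E.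
  rewrite integral_kernelZ//; last by rewrite mulr_ge0// ltW.
  have := kernel_near_set_ge n0 s0 oOm bOm Ox Theta_ge.
  move=> /(lee_wpmul2l (_ : 0 <= (slope g * `|u x|)%:E)%E) H.
  apply: le_trans (H _); last by rewrite lee_fin mulr_ge0// ltW.
  by rewrite -EFinM lee_fin /coefU le_eqVlt; apply/orP; left; apply/eqP; field.
have I1 : (\int[mu]_(y in Nr) phi1 y <=
    coefT%:E * near_tail x + (coefN * d `^ (1 - s))%:E)%E.
  rewrite /phi1; under eq_integral do rewrite EFinD EFinM.
  rewrite ge0_integralD//; last 4 first.
  - by move=> y _; rewrite mule_ge0 ?lee_fin ?mulr_ge0 ?kernel_ge0 ?(ltW coefT_gt0).
  - by apply: measurable_funTS; apply: measurable_funeM; exact: meu.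
  - by move=> y _; rewrite lee_fin mulr_ge0 ?kernel_ge0 ?ltW.
  - apply: measurable_funTS; apply/measurable_EFinP; apply: measurable_funM => //.
    exact: measurable_kernelr.
  rewrite ge0_integralZl_EFin//; last 3 first.
  - by move=> y _; rewrite lee_fin mulr_ge0 ?kernel_ge0.
  - by apply: measurable_funTS; exact: meu.
  - exact: ltW coefT_gt0.
  apply: leeD => //; rewrite integral_kernelZ ?(ltW S0)//.
  have := kernel_near_set_le n0 s0 s1 oOm bOm Ox T0.
  move=> /(lee_wpmul2l (_ : 0 <= (slope g)%:E)%E) H.
  apply: le_trans (H _) _; first by rewrite lee_fin ltW.
  by rewrite -EFinM lee_fin /coefN !mulrA.
have I2 : (\int[mu]_(y in Fr) phi2 y <= (coefU * d `^ (- s) * `|u x|)%:E)%E.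
  rewrite integral_kernelZ ?mulr_ge0//.
  have := kernel_far_set_le n0 s0 oOm bOm Ox T0.
  move=> /(lee_wpmul2l (_ : 0 <= (mass g * `|u x|)%:E)%E) H.
  apply: le_trans (H _) _; first by rewrite lee_fin mulr_ge0.
  rewrite -EFinM lee_fin.
  have := Theta_absorbs; rewrite -/coefU.
  move=> /(ler_wpM2r (_ : 0 <= d `^ (- s) * `|u x|)) K.
  rewrite -[leRHS]mulrA; apply: le_trans (K _); last by rewrite mulr_ge0 ?powR_ge0.
  by rewrite le_eqVlt; apply/orP; left; apply/eqP; ring.
have I1oo : (\int[mu]_(y in Nr) phi1 y < +oo)%E.
  apply: le_lt_trans I1 _; rewrite lte_add_pinfty ?ltry//.
  by rewrite lte_mul_pinfty ?lee_fin// ltW// coefT_gt0.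
have xy y : ~ Om y -> x <> y by move=> nO xy; apply: nO; rewrite -xy.
have [] := @integral_le_signedD _ _ _ mu (~` Om)
  (fun y => (integrandN g M s cut x y)%:E + (phi0 \_ Nr) y)%E
  (fun y => (integrandN g M s u x y)%:E)
  (fun y => (phi1 \_ Nr) y + (phi2 \_ Fr) y)%E mCOm.
- apply: emeasurable_funD; last exact: mr.
  by apply: measurable_funTS; apply: meN; exact: measurable_cut.
- by apply: measurable_funTS; exact: meN.
- by apply: emeasurable_funD; exact: mr.
- move=> y Oy; rewrite adde_ge0 ?r0// lee_fin.
  by have /andP[] := integrandN_bounds s g_cont g_gt0 g_le1 g_int M0 (xy y Oy) (cut_in Ox).
- by move=> y Oy; rewrite adde_ge0 ?r0.
- move=> y Oy _; have := Oy; rewrite DE => -[yN|yF].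
    have yF : y \notin Fr by rewrite notin_setE => /(_ yN.1).
    rewrite !patchE (mem_set yN) (negbTE yF) adde0 /phi0 /phi1 -!EFinD lee_fin.
    rewrite [coefT * _]mulrA.
    exact: (integrandN_near M s g_cont g_gt0 g_le1 g_int (xy y Oy) (cut_in Ox) (cut_out Oy)).
  have yN : y \notin Nr by rewrite notin_setE => -[].
  rewrite !patchE (mem_set yF) (negbTE yN) adde0 add0e /phi2 -!EFinD lee_fin.
  exact: (integrandN_far M s g_cont g_gt0 g_le1 g_int (xy y Oy) (cut_in Ox) (cut_out Oy)).
- rewrite ge0_integralD//; [|by move=> y _; exact: r0|exact: mr|by move=> y _; exact: r0|exact: mr].
  rewrite !ir// lte_add_pinfty//.
  by apply: le_lt_trans I2 _; exact: ltry.
rewrite ge0_integralD//; last 4 first.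
- move=> y Oy; rewrite lee_fin.
  by have /andP[] := integrandN_bounds s g_cont g_gt0 g_le1 g_int M0 (xy y Oy) (cut_in Ox).
- by apply: measurable_funTS; apply: meN; exact: measurable_cut.
- by move=> y _; exact: r0.
- exact: mr.
rewrite ge0_integralD//; [|by move=> y _; exact: r0|exact: mr|by move=> y _; exact: r0|exact: mr].
rewrite !ir// -/(crossing cut x) -/(crossing u x) => H fu; split=> //.
have E2 : 2 * coefU * d `^ (- s) * `|u x| =
    coefU * d `^ (- s) * `|u x| + coefU * d `^ (- s) * `|u x|.
  by rewrite -!mulrA mulr_natl mulr2n.
rewrite E2 in I0.
exact: lee_cancel_half (le_trans (le_trans (leeD2l _ I0) H) (leeD2l _ (leeD I1 I2))).
Qed.

End comparison.

(** * Integration over the domain and use of minimality *)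

Section energy_estimate.
Context {R : realType} {n : nat}.
Variables (g : R -> R) (M s : R) (Om : set 'rV[R]_n) (u : 'rV[R]_n -> R).
Hypothesis g_cont : continuous g.
Hypothesis g_gt0 : forall t : R, 0 < g t.
Hypothesis g_le1 : forall t : R, g t <= 1.
Hypothesis g_int : (\int[@lebesgue_measure R]_t (g t * `|t|)%:E < +oo)%E.
Hypothesis M0 : 0 <= M.
Hypothesis (n0 : (0 < n)%N) (s0 : 0 < s) (s1 : s < 1).
Hypothesis (oOm : open Om) (bOm : bounded_set Om) (lOm : lipschitz_boundary Om).
Hypothesis u_meas : measurable_fun setT u.
Local Notation mu := (lebesgue_rV R n).
Local Notation d := (diam Om).
Local Notation p := (n%:R + s).
Local Notation q := (n%:R - 1 + s).
Local Notation v := (cut Om u).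
Local Notation cU := (@coefU R n g s).
Local Notation cN := (@coefN R n g s).
Local Notation cA := (@coefA R n g s).

Definition self_interaction (x : 'rV[R]_n) : \bar R :=
  (\int[mu]_(y in Om) (integrandA g s u x y)%:E)%E.

Definition seminorm_density (x : 'rV[R]_n) : \bar R :=
  (\int[mu]_(y in Om) (`|u x - u y| * kernel p x y)%:E)%E.

Let mOm : measurable Om. Proof. exact: open_measurable_rV. Qed.
Let mCOm : measurable (~` Om). Proof. exact: measurableC. Qed.
Let S0 : 0 < slope g. Proof. exact: slope_gt0. Qed.
Let L0 : 0 <= mass g. Proof. exact: mass_ge0. Qed.

Lemma measurable_crossing (w : 'rV[R]_n -> R) : measurable_fun setT w ->
  measurable_fun setT (crossing g M s Om w).
Proof.
move=> mw.
apply: (@measurable_integral_param _ _ _ _ _ mu (~` Om)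
  (fun z => (integrandN g M s w z.1 z.2)%:E)) => //.
by apply/measurable_EFinP; exact: measurable_integrandN.
Qed.

Lemma measurable_near_tail : measurable_fun setT (near_tail g s Om u).
Proof.
apply: (@measurable_ge0_integral_param _ _ _ _ _ mu (near_set Om (@Theta R n g s))
  (fun z => (`|u z.2| * kernel p z.1 z.2)%:E)).
- exact: measurable_near_set.
- apply/measurable_EFinP; apply: measurable_abs_kernel.
  by apply: measurableT_comp.
- by move=> z; rewrite lee_fin mulr_ge0 ?kernel_ge0.
Qed.

Lemma near_tail_ge0 x : (0 <= near_tail g s Om u x)%E.
Proof. by apply: integral_ge0 => y _; rewrite lee_fin mulr_ge0 ?kernel_ge0. Qed.

Lemma lebesgue_domain_lty : (mu Om < +oo)%E.
Proof.
have [K [_ bK]] := bOm.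
have K0 : 0 < `|K| + 2 by rewrite ltr_pwDr.
apply: (@le_lt_trans _ _ (mu (cube 0 (`|K| + 2)))).
  apply: le_measure; rewrite ?inE//; first exact: measurable_cube.
  move=> x Ox; apply/cubeP => //; rewrite sub0r normrN.
  have : `|x| <= `|K| + 1 by apply: bK => //; rewrite ltr_pwDr// ler_norm.
  by move=> /le_lt_trans; apply; rewrite ltrD2l ltr1n.
by rewrite lebesgue_cube ?(ltW K0)// ltry.
Qed.

Let integral_cstOm (c : R) : (\int[mu]_(x in Om) c%:E = c%:E * mu Om)%E.
Proof. exact: integral_cst. Qed.

Let mabs : measurable_fun setT (fun x => (`|u x|)%:E).
Proof. by apply/measurable_EFinP; apply: measurableT_comp. Qed.

Lemma crossing_comparison : Om !=set0 ->
    (\int[mu]_(x in Om) near_tail g s Om u x < +oo)%E ->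
  (\int[mu]_(x in Om) crossing g M s Om v x +
     (cU * d `^ (- s))%:E * \int[mu]_(x in Om) (`|u x|)%:E <=
   \int[mu]_(x in Om) crossing g M s Om u x +
     ((coefT g)%:E * \int[mu]_(x in Om) near_tail g s Om u x +
      (cN * d `^ (1 - s))%:E * mu Om))%E /\
  (\int[mu]_(x in Om) crossing g M s Om u x != -oo)%E.
Proof.
move=> Om0 tfin; have d0 : 0 < d by exact: diam_gt0.
have mv : measurable_fun setT v by exact: measurable_cut.
have cu : 0 <= cU * d `^ (- s).
  by rewrite mulr_ge0 ?powR_ge0// ltW//; exact: coefU_gt0.
have cn : 0 <= cN * d `^ (1 - s).
  by rewrite mulr_ge0 ?powR_ge0// ltW//; exact: coefN_gt0.
have ct : 0 < coefT g by exact: coefT_gt0.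
have xy x y : Om x -> ~ Om y -> x <> y by move=> Ox nO xy; apply: nO; rewrite -xy.
have v0 x : Om x -> (0 <= crossing g M s Om v x)%E.
  move=> Ox; apply: integral_ge0 => y Oy; rewrite lee_fin.
  by have /andP[] := integrandN_bounds s g_cont g_gt0 g_le1 g_int M0 (xy _ y Ox Oy) (cut_in u Ox).
have mtt : measurable_fun setT (fun x => (coefT g)%:E * near_tail g s Om u x)%E.
  by apply: measurable_funeM; exact: measurable_near_tail.
have mau : measurable_fun setT (fun x => (cU * d `^ (- s) * `|u x|)%:E).
  apply/measurable_EFinP; apply: measurable_funM => //.
  by apply/measurable_EFinP.
have eT : (\int[mu]_(x in Om) ((coefT g)%:E * near_tail g s Om u x + (cN * d `^ (1 - s))%:E) =
   (coefT g)%:E * \int[mu]_(x in Om) near_tail g s Om u x +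
      (cN * d `^ (1 - s))%:E * mu Om)%E.
  rewrite ge0_integralD//; last 2 first.
  - by move=> x _; rewrite mule_ge0 ?near_tail_ge0// lee_fin ltW.
  - exact: measurable_funTS.
  rewrite integral_cstOm ge0_integralZl_EFin//; last 3 first.
  - by move=> x _; exact: near_tail_ge0.
  - by apply: measurable_funTS; exact: measurable_near_tail.
  - exact: ltW.
have [] := @integral_le_signedD _ _ _ mu Om
  (fun x => crossing g M s Om v x + (cU * d `^ (- s) * `|u x|)%:E)%E
  (crossing g M s Om u)
  (fun x => (coefT g)%:E * near_tail g s Om u x + (cN * d `^ (1 - s))%:E)%E mOm.
- apply: measurable_funTS; apply: emeasurable_funD => //.
  exact: measurable_crossing.
- by apply: measurable_funTS; exact: measurable_crossing.
- by apply: measurable_funTS; apply: emeasurable_funD.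
- by move=> x Ox; rewrite adde_ge0 ?v0// lee_fin mulr_ge0.
- by move=> x Ox; rewrite adde_ge0 ?lee_fin// mule_ge0 ?near_tail_ge0// lee_fin ltW.
(* Since [coefT g] is positive, finiteness of the right-hand side at x forces the near tail at x to
   be finite; the points where it is infinite are left out by the guard of [integral_le_signedD]. *)
- move=> x Ox hx.
  have [] := crossing_le g_cont g_gt0 g_le1 g_int M0 n0 s0 s1 oOm bOm u_meas Ox => //.
  rewrite ltNge leye_eq; apply/negP => /eqP tE.
  by move: hx; rewrite tE gt0_muley ?lte_fin// addye.
- rewrite eT lte_add_pinfty//.
    by rewrite lte_mul_pinfty// lee_fin ltW.
  by rewrite lte_mul_pinfty ?lee_fin// lebesgue_domain_lty.
rewrite eT ge0_integralD//; last 3 first.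
- by apply: measurable_funTS; exact: measurable_crossing.
- by move=> x _; rewrite lee_fin mulr_ge0.
- exact: measurable_funTS.
rewrite [in X in (_ + X <= _)%E -> _](_ : (\int[mu]_(x in Om) _)%E =
  ((cU * d `^ (- s))%:E * \int[mu]_(x in Om) (`|u x|)%:E)%E); first by [].
under eq_integral do rewrite EFinM.
rewrite ge0_integralZl_EFin//; exact: measurable_funTS.
Qed.

(** Integrates [integrandA_coercive] twice; the constant lost in the linear growth becomes the
    kernel of order n - 1 + s over the domain, hence the term with d^(1 - s). *)
Lemma seminorm_comparison : Om !=set0 ->
  ((slope g)%:E * \int[mu]_(x in Om) seminorm_density x <=
   \int[mu]_(x in Om) self_interaction x + (cA * d `^ (1 - s))%:E * mu Om)%E.
Proof.
move=> Om0; have d0 : 0 < d by exact: diam_gt0.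
have ca : 0 <= cA * d `^ (1 - s).
  by rewrite mulr_ge0 ?powR_ge0// ltW//; exact: coefA_gt0.
have mAz : measurable_fun setT (fun z => (integrandA g s u z.1 z.2)%:E).
  by apply/measurable_EFinP; exact: measurable_integrandA.
have mSz : measurable_fun setT (fun z : 'rV[R]_n * 'rV[R]_n =>
    (`|u z.1 - u z.2| * kernel p z.1 z.2)%:E).
  apply/measurable_EFinP; apply: measurable_abs_kernel.
  by apply: measurable_funB; apply: measurableT_comp.
have mA : measurable_fun setT self_interaction.
  apply: (@measurable_ge0_integral_param _ _ _ _ _ mu Om _ mOm mAz) => z.
  by rewrite lee_fin integrandA_ge0.
have mS : measurable_fun setT seminorm_density.
  apply: (@measurable_ge0_integral_param _ _ _ _ _ mu Om _ mOm mSz) => z.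
  by rewrite lee_fin mulr_ge0 ?kernel_ge0.
have sA x : (0 <= self_interaction x)%E.
  by apply: integral_ge0 => y _; rewrite lee_fin integrandA_ge0.
have sS x : (0 <= seminorm_density x)%E.
  by apply: integral_ge0 => y _; rewrite lee_fin mulr_ge0 ?kernel_ge0.
have mAO := measurable_funTS mA (D := Om).
have mSO := measurable_funTS mS (D := Om).
rewrite -integral_cstOm -ge0_integralD//.
rewrite -ge0_integralZl_EFin//; last first.
- exact: ltW.
apply: ge0_le_integral_ae => [x _|x _|].
- by rewrite mule_ge0// lee_fin ltW.
- by rewrite adde_ge0// lee_fin.
apply: aeW => x Ox.
have mk r : measurable_fun Om (fun y => (kernel r x y)%:E).
  by apply: measurable_funTS; apply/measurable_EFinP; exact: measurable_kernelr.
have mAx : measurable_fun Om (fun y => (integrandA g s u x y)%:E).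
  by apply: measurable_funTS; exact: (measurableT_comp mAz (measurable_pair1 x)).
have mSx : measurable_fun Om (fun y => (`|u x - u y| * kernel p x y)%:E).
  by apply: measurable_funTS; exact: (measurableT_comp mSz (measurable_pair1 x)).
rewrite /seminorm_density -ge0_integralZl_EFin//; last 2 first.
- by move=> y _; rewrite lee_fin mulr_ge0 ?kernel_ge0.
- exact: ltW.
apply: (@le_trans _ _ (\int[mu]_(y in Om) ((integrandA g s u x y)%:E +
    (slope g)%:E * (kernel q x y)%:E))%E).
  apply: ge0_le_integral_ae => [y _|y _|].
  - by rewrite -EFinM lee_fin mulr_ge0 ?(ltW S0)// mulr_ge0 ?kernel_ge0.
  - by rewrite -EFinM -EFinD lee_fin addr_ge0 ?integrandA_ge0// mulr_ge0 ?kernel_ge0 ?(ltW S0).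
  by apply: aeW => y _; rewrite -!EFinM -EFinD lee_fin integrandA_coercive.
rewrite ge0_integralD//; last 3 first.
- by move=> y _; rewrite lee_fin integrandA_ge0.
- by move=> y _; rewrite -EFinM lee_fin mulr_ge0 ?kernel_ge0 ?(ltW S0).
- exact: measurable_funeM.
apply: leeD => //.
rewrite ge0_integralZl_EFin//; last 2 first.
- by move=> y _; rewrite lee_fin kernel_ge0.
- exact: ltW.
have := kernel_domain_le n0 s0 s1 oOm bOm Ox.
move=> /(lee_wpmul2l (_ : 0 <= (slope g)%:E)%E) H.
apply: le_trans (H _) _; first by rewrite lee_fin ltW.
by rewrite -EFinM lee_fin /coefA !mulrA.
Qed.

(** The bound 2 M mass times the perimeter depends on M and on the shape of the domain, but only its
    finiteness is passed on. *)
Lemma crossing_cut_lty : (\int[mu]_(x in Om) crossing g M s Om v x < +oo)%E.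
Proof.
pose c := mass g * (2 * M); have c0 : 0 <= c by rewrite !mulr_ge0.
have xy x y : Om x -> ~ Om y -> x <> y by move=> Ox nO xy; apply: nO; rewrite -xy.
apply: (@le_lt_trans _ _ (\int[mu]_(x in Om) (c%:E * exit_rate s Om x))%E).
  apply: ge0_le_integral_ae => [x Ox|x _|].
  - apply: integral_ge0 => y Oy; rewrite lee_fin.
    by have /andP[] := integrandN_bounds s g_cont g_gt0 g_le1 g_int M0 (xy _ y Ox Oy) (cut_in u Ox).
  - by rewrite mule_ge0 ?exit_rate_ge0.
  apply: aeW => x Ox; rewrite /exit_rate -ge0_integralZl_EFin//; last 2 first.
  - by move=> y _; rewrite lee_fin kernel_ge0.
  - by apply: measurable_funTS; apply/measurable_EFinP; exact: measurable_kernelr.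
  apply: ge0_le_integral_ae => [y Oy|y _|].
  - rewrite lee_fin.
    by have /andP[] := integrandN_bounds s g_cont g_gt0 g_le1 g_int M0 (xy _ y Ox Oy) (cut_in u Ox).
  - by rewrite -EFinM lee_fin mulr_ge0 ?kernel_ge0.
  apply: aeW => y Oy; rewrite -EFinM lee_fin.
  by have /andP[] := integrandN_bounds s g_cont g_gt0 g_le1 g_int M0 (xy _ y Ox Oy) (cut_in u Ox).
rewrite ge0_integralZl_EFin//; last 2 first.
- by move=> x _; exact: exit_rate_ge0.
- by apply: measurable_funTS; exact: measurable_exit_rate.
by rewrite lte_mul_pinfty ?lee_fin// exit_rate_lty.
Qed.

Lemma energy_estimate : Om !=set0 ->
    (\int[mu]_(x in Om) near_tail g s Om u x < +oo)%E ->
    (\int[mu]_(x in Om) self_interaction x + \int[mu]_(x in Om) crossing g M s Om u x <=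
     \int[mu]_(x in Om) crossing g M s Om v x)%E ->
  ((cU * d `^ (- s))%:E * \int[mu]_(x in Om) (`|u x|)%:E +
   (slope g)%:E * \int[mu]_(x in Om) seminorm_density x <=
   (coefT g)%:E * \int[mu]_(x in Om) near_tail g s Om u x +
     ((cN + cA) * d `^ (1 - s))%:E * mu Om)%E.
Proof.
move=> Om0 tfin hmin.
have [h1 _] := crossing_comparison Om0 tfin.
have h2 := seminorm_comparison Om0.
have vfin : (\int[mu]_(x in Om) crossing g M s Om v x)%E \is a fin_num.
  rewrite ge0_fin_numE ?crossing_cut_lty//; apply: integral_ge0 => x Ox.
  apply: integral_ge0 => y Oy; rewrite lee_fin.
  have xy : x <> y by move=> xy; apply: Oy; rewrite -xy.
  by have /andP[] := integrandN_bounds s g_cont g_gt0 g_le1 g_int M0 xy (cut_in u Ox).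
(* With the finite N(v) added on both sides, the sum of h1 and h2 applies, and minimality bounds
   A(u) + N(u), regrouped in front, by that same N(v). *)
rewrite -(leeD2lE _ _ vfin) addeA; apply: (le_trans (leeD h1 h2)).
rewrite [leLHS](_ : _ = (\int[mu]_(x in Om) self_interaction x + \int[mu]_(x in Om) crossing g M s Om u x) +
  ((coefT g)%:E * \int[mu]_(x in Om) near_tail g s Om u x +
     ((cN + cA) * d `^ (1 - s))%:E * mu Om))%E; first by rewrite leeD2r.
have -> : (((cN + cA) * d `^ (1 - s))%:E * mu Om =
    (cN * d `^ (1 - s))%:E * mu Om + (cA * d `^ (1 - s))%:E * mu Om)%E.
  rewrite mulrDl EFinD ge0_muleDl// lee_fin mulr_ge0 ?powR_ge0// ltW//.
    exact: coefN_gt0.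
  exact: coefA_gt0.
move: (\int[mu]_(x in Om) self_interaction x)%E (\int[mu]_(x in Om) crossing g M s Om u x)%E => a b.
move: (_ * \int[mu]_(x in Om) near_tail g s Om u x)%E (_ * mu Om)%E (_ * mu Om)%E => t x y.
by rewrite addeACA (addeC b) -(addeA t).
Qed.

End energy_estimate.

(** * Passage to a Borel representative *)

Section ae_replacement.
Context {R : realType} {n : nat}.
Local Notation mu := (lebesgue_rV R n).

Lemma integral_ae_replace (A : set 'rV[R]_n) (u h : 'rV[R]_n -> R)
    (Phi : R -> 'rV[R]_n -> \bar R) :
    {ae mu, forall x, A x -> u x = h x} ->
  (\int[mu]_(x in A) Phi (u x) x = \int[mu]_(x in A) Phi (h x) x)%E.
Proof.
by move=> uh; apply: integral_ae_eq; apply: filterS uh => x /[apply] ->.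
Qed.

(** One null set of R^n serves both variables: for x outside it, the inner integrand changes only
    for y inside it. The sections are treated one at a time, without Fubini on the product. *)
Lemma integral2_ae_replace (A B : set 'rV[R]_n) (u h : 'rV[R]_n -> R)
    (Phi : R -> R -> 'rV[R]_n -> 'rV[R]_n -> \bar R) :
    {ae mu, forall x, u x = h x} ->
  (\int[mu]_(x in A) \int[mu]_(y in B) Phi (u x) (u y) x y =
   \int[mu]_(x in A) \int[mu]_(y in B) Phi (h x) (h y) x y)%E.
Proof.
move=> uh; apply: integral_ae_eq; apply: filterS (uh) => x uhx Ax.
rewrite uhx; apply: (@integral_ae_replace B u h (fun t y => Phi (h x) t x y)).
by apply: filterS uh => y + _.
Qed.

Lemma funcA_ae (s : R) (g : R -> R) (u h : 'rV[R]_n -> R) Om :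
  {ae mu, forall x, u x = h x} -> funcA s g u Om = funcA s g h Om.
Proof.
exact: (@integral2_ae_replace Om Om u h (fun a b x y =>
  (primG2 g ((a - b) / enorm (x - y)) / enorm (x - y) `^ (n%:R - 1 + s))%:E)).
Qed.

Lemma funcN_ae (s : R) (g : R -> R) (M : R) (u h : 'rV[R]_n -> R) Om :
  {ae mu, forall x, u x = h x} -> funcN s g M u Om = funcN s g M h Om.
Proof.
exact: (@integral2_ae_replace Om (~` Om) u h (fun a b x y =>
  ((oriented_int (barG g) ((- M - b) / enorm (x - y)) ((a - b) / enorm (x - y))
    + oriented_int (fun t => barG g (- t))
       ((a - b) / enorm (x - y)) ((M - b) / enorm (x - y)))
    / enorm (x - y) `^ (n%:R - 1 + s))%:E)).
Qed.

Lemma funcF_ae (s : R) (g : R -> R) (M : R) (u h : 'rV[R]_n -> R) Om :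
  {ae mu, forall x, u x = h x} -> funcF s g M u Om = funcF s g M h Om.
Proof. by move=> uh; rewrite /funcF (funcA_ae s g Om uh) (funcN_ae s g M Om uh). Qed.

End ae_replacement.

Lemma primG2_0 (R : realType) (g : R -> R) : primG2 g 0 = 0.
Proof. by rewrite /primG2 oriented_int_le// Rintegral_itv1. Qed.

(** * The competitor, and the collection of the constants *)

Section cut_competitor.
Context {R : realType} {n : nat}.
Variables (s : R) (Om : set 'rV[R]_n) (h : 'rV[R]_n -> R).
Local Notation mu := (lebesgue_rV R n).

Lemma cut_Ws : open Om -> measurable_fun setT h -> Ws s Om (cut Om h).
Proof.
move=> oOm mh; split.
- exists (cut Om h); first exact: measurable_cut.
  exact: aeW.
- rewrite /normL1 integral0_eq ?ltry// => x Ox.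
  by rewrite /= cut_in// normr0.
- rewrite /seminormWs1 integral0_eq ?ltry// => x Ox.
  apply: integral0_eq => y Oy.
  by rewrite !cut_in// subrr normr0 mul0r.
Qed.

Lemma funcF_cut (g : R -> R) (M : R) :
  (funcF s g M (cut Om h) Om =
   \int[mu]_(x in Om) crossing g M s Om (cut Om h) x)%E.
Proof.
rewrite /funcF [X in (X + _)%E](_ : _ = 0%E) ?add0e//.
apply: integral0_eq => x Ox; apply: integral0_eq => y Oy.
by rewrite !cut_in// subrr mul0r primG2_0 mul0r.
Qed.

End cut_competitor.

(** Explains the form of C: on the left both coefficients are lowered to their minimum, on the right
    both are raised to their sum. *)
Lemma energy_estimate_normalized (R : realType) (c1 c2 c3 c4 d1 d2 : R)
    (U B T m : \bar R) :
    0 < c1 -> 0 < c2 -> 0 < c3 -> 0 < c4 -> 0 <= d1 -> 0 <= d2 ->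
    (0 <= U -> 0 <= B -> 0 <= T -> 0 <= m ->
     (c1 * d1)%:E * U + c2%:E * B <= c3%:E * T + (c4 * d2)%:E * m ->
     d1%:E * U + B <=
       ((c3 + c4) / Num.min c1 c2)%:E * (T + d2%:E * m))%E.
Proof.
move=> c10 c20 c30 c40 d10 d20 U0 B0 T0 m0 H.
set c := Num.min c1 c2; have c0 : 0 < c by rewrite lt_min c10.
have dU : (0 <= d1%:E * U)%E by rewrite mule_ge0.
have dm : (0 <= d2%:E * m)%E by rewrite mule_ge0.
rewrite mulrC EFinM -muleA -lee_pdivrMl ?invr_gt0// invrK.
apply: (@le_trans _ _ (c1%:E * (d1%:E * U) + c2%:E * B)%E).
  rewrite ge0_muleDr//; apply: leeD; apply: lee_wpmul2r => //;
  by rewrite lee_fin ge_min lexx ?orbT.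
rewrite muleA -EFinM; apply: (le_trans H).
rewrite EFinM -muleA ge0_muleDr//; apply: leeD; apply: lee_wpmul2r => //;
by rewrite lee_fin ?lerDl ?lerDr ltW.
Qed.

Unset Implicit Arguments.

Theorem proposition3p2 (R : realType) (n : nat) (s : R) (g : R -> R)
    (n_ge1 : (1 <= n)%N) (s_gt0 : 0 < s) (s_lt1 : s < 1)
    (g_cont : continuous g) (g_even : forall t : R, g (- t) = g t)
    (g_gt0 : forall t : R, 0 < g t) (g_le1 : forall t : R, g t <= 1)
    (g_int : (\int[@lebesgue_measure R]_t (g t * `|t|)%:E < +oo)%E) :
  exists Theta C : R, 0 < Theta /\ 0 < C /\
    forall (Omega : set 'rV[R]_n) (phi u : 'rV[R]_n -> R) (M : R),
      open Omega -> bounded_set Omega -> lipschitz_boundary Omega ->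
      lebesgue_measurable_fun (~` Omega) phi ->
      (normL1 Omega
         (Tail s phi (enlarge Omega (Theta * diam Omega) `\` Omega)) < +oo)%E ->
      Ws_datum s Omega phi u ->
      0 <= M ->
      (forall v : 'rV[R]_n -> R, Ws_datum s Omega phi v ->
         {ae lebesgue_rV R n, forall x, Omega x -> `|v x| <= M} ->
         (funcF s g M u Omega <= funcF s g M v Omega)%E) ->
      ((diam Omega `^ (- s))%:E * normL1 Omega (EFin \o u)
         + seminormWs1 s Omega u
       <= C%:E * (normL1 Omega
            (Tail s phi (enlarge Omega (Theta * diam Omega) `\` Omega))
         + (diam Omega `^ (1 - s))%:E * lebesgue_rV R n Omega))%E.
Proof.
exists (@Theta R n g s).
exists ((coefT g + (@coefN R n g s + @coefA R n g s)) /
  Num.min (@coefU R n g s) (slope g)).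
have S0 : 0 < slope g by exact: slope_gt0.
have cT := coefT_gt0 g_cont g_gt0.
have cU := coefU_gt0 s g_cont g_gt0 n_ge1.
have cN := coefN_gt0 g_cont g_gt0 n_ge1 s_gt0 s_lt1.
have cA := coefA_gt0 g_cont g_gt0 n_ge1 s_gt0 s_lt1.
split; first exact: Theta_gt0.
split.
  by apply: divr_gt0; [exact: addr_gt0 cT (addr_gt0 cN cA)|rewrite lt_min cU].
move=> Om phi u M oOm bOm lOm _ tail_fin [[[h mh uh] _ _] uphi] M0 umin.
have {}uh : {ae lebesgue_rV R n, forall x, u x = h x}.
  by apply: filterS uh => x; apply.
have hphi : {ae lebesgue_rV R n, forall x, (~` Om) x -> phi x = h x}.
  by apply: filterS2 uh uphi => x -> /[apply].
(* The near set lies outside Om, where phi, u and h agree almost everywhere, so the tail of the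
   datum is the tail of the representative. *)
have tailE x : Tail s phi (enlarge Om (@Theta R n g s * diam Om) `\` Om) x =
    near_tail g s Om h x.
  apply: (@integral_ae_replace _ _ (near_set Om (@Theta R n g s)) phi h
    (fun t y => (`|t| * kernel (n%:R + s) x y)%:E)).
  by apply: filterS hphi => y hy [_]; exact: hy.
have normTail : normL1 Om (Tail s phi (enlarge Om (@Theta R n g s * diam Om) `\` Om)) =
    (\int[lebesgue_rV R n]_(x in Om) near_tail g s Om h x)%E.
  by apply: eq_integral => x _; rewrite tailE gee0_abs// near_tail_ge0.
rewrite normTail in tail_fin *.
have normU : normL1 Om (EFin \o u) =
    (\int[lebesgue_rV R n]_(x in Om) (`|h x|)%:E)%E.
  apply: (@integral_ae_replace _ _ Om u h (fun t y => (`|t|)%:E)).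
  by apply: filterS uh => x ux _.
have semiU : seminormWs1 s Om u =
    (\int[lebesgue_rV R n]_(x in Om) seminorm_density s Om h x)%E.
  exact: (@integral2_ae_replace _ _ Om Om u h (fun a b x y =>
    (`|a - b| / enorm (x - y) `^ (n%:R + s))%:E)).
rewrite normU semiU.
(* The estimates require a positive diameter; for the empty domain both sides are 0. *)
have [Om0|] := pselect (Om !=set0); last first.
  move=> /nonemptyPn ->; rewrite !integral_set0 mule0 add0e.
  by rewrite measure0 mule0 adde0 mule0.
apply: (energy_estimate_normalized cU S0 cT (addr_gt0 cN cA)
  (powR_ge0 _ _) (powR_ge0 _ _)).
- exact: integral_ge0.
- apply: integral_ge0 => x _; apply: integral_ge0 => y _.
  by rewrite lee_fin mulr_ge0 ?kernel_ge0.
- by apply: integral_ge0 => x _; exact: near_tail_ge0.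
- exact: measure_ge0.
apply: (energy_estimate g_cont g_gt0 g_le1 g_int M0 n_ge1 s_gt0 s_lt1
  oOm bOm lOm mh Om0 tail_fin).
(* The competitor is cut from the representative h, not from u; it is admissible because |0| <= M,
   and its energy consists of the cross term alone. *)
have := umin (cut Om h); rewrite (funcF_ae _ _ _ _ uh) funcF_cut; apply.
- split; first exact: cut_Ws.
  by apply: filterS hphi => x hx nOx; rewrite hx// cut_out.
- by apply: aeW => x Ox; rewrite cut_in// normr0.
Qed.
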